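(* Fix an integer $k\ge1$ and $l\in\{0,\dots,k\}$. The map $$1\mapsto [[\ ]],\qquad \varphi^{\ast p_n}_{j_n}\cdots\varphi^{\ast p_1}_{j_1}\longmapsto[[j_n-p_n,\dots,j_1-p_1]]$$ (with region sequence $m_s=(-1)^{p_1}+\cdots+(-1)^{p_s}$) induces an isomorphism of $(\widehat{sl_2})_1$ crystals with affine weights $$\bigsqcup_{n=0}^\infty\ \bigsqcup_{(p_n,\dots,p_1)\in\mathcal P^k_{res,n}(0,l)}B_{\ge0}(p_n,\dots,p_1)\ \simeq\ B(\lambda_l),$$ where $B(\lambda_l)$ is identified with $B(\lambda_l)\otimes b_{-\lambda_0}\subset B(\lambda_l)\otimes B(\lambda_0)^\ast=\mathcal P^{(l,0)}$ via $b\mapsto b\otimes b_{-\lambda_0}$. That is, the map is a bijection onto $B(\lambda_l)\otimes b_{-\lambda_0}$ which commutes with $\tilde e_1,\tilde f_1$ and preserves the affine weights (in $P$).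
   Context: **Weights.** $P=\mathbb Z\Lambda_0\oplus\mathbb Z\Lambda_1\oplus\mathbb Z\delta$ is the weight lattice of $\widehat{sl_2}$, $\lambda_l=(k-l)\Lambda_0+l\Lambda_1$. $B(\lambda)$ is the crystal of the integrable highest weight $U_q(\widehat{sl_2})$-module $V(\lambda)$; $B(\lambda)^\ast$ is the dual (lowest weight) crystal with lowest weight element $b_{-\lambda}$. An $(\widehat{sl_2})_1$ crystal is an $\widehat{sl_2}$ crystal in which one forgets $\tilde e_0,\tilde f_0$. **Creation algebra.** $H(0,0)=H(0,1)=H(1,1)=0$, $H(1,0)=1$, $K=1-H$; $\epsilon(j)=0$ for $j$ even, $1$ for $j$ odd. $\mathcal A$ is the associative unital $\mathbb Z$-algebra with generators $\varphi^{\ast p}_j$ ($j\in\mathbb Z$, $p\in\{0,1\}$) and relations $$\varphi^{\ast p_2}_{j_2}\varphi^{\ast p_1}_{j_1}+\varphi^{\ast p_2}_{j_1-2K(p_2,p_1)+\epsilon(j_1+j_2)}\varphi^{\ast p_1}_{j_2+2K(p_2,p_1)-\epsilon(j_1+j_2)}=0,$$ where, if the two monomials coincide, the relation is read as: that monomial is $0$. For $(p_n,\dots,p_1)\in\{0,1\}^n$, $B(p_n,\dots,p_1)$ is the set of monomials $\varphi^{\ast p_n}_{j_n}\cdots\varphi^{\ast p_1}_{j_1}$ with $j_{r+1}-j_r\ge 2H(p_{r+1},p_r)$ for $1\le r\le n-1$, and $B_{\ge0}(p_n,\dots,p_1)$ is its subset with $j_1\ge0$. For $n=0$ both are $\{1\}$.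 Every monomial in the generators with upper indices $(p_n,\dots,p_1)$ is $0$ or $\pm$ a unique element of $B(p_n,\dots,p_1)$. **Crystal structure.** The weight of a monomial is the sum of the weights $wt(\varphi^{\ast p}_j)=-\lfloor j/2\rfloor\delta+(1-2\epsilon(j))(\Lambda_1-\Lambda_0)$; $wt(1)=0$. On $B(p)=\{\varphi^{\ast p}_j\}$: $\tilde f_1\varphi^{\ast p}_{2j}=\varphi^{\ast p}_{2j+1}$, $\tilde e_1\varphi^{\ast p}_{2j+1}=\varphi^{\ast p}_{2j}$, other actions of $\tilde e_1,\tilde f_1$ being $0$. Tensor products of crystals use the rule (with $\varepsilon_i(b)=\max\{m:\tilde e_i^mb\ne0\}$, $\phi_i(b)=\max\{m:\tilde f_i^mb\neq0\}$): $\tilde f_i(b\otimes b')=\tilde f_ib\otimes b'$ if $\phi_i(b)>\varepsilon_i(b')$, else $b\otimes\tilde f_ib'$; $\tilde e_i(b\otimes b')=\tilde e_ib\otimes b'$ if $\phi_i(b)\ge\varepsilon_i(b')$, else $b\otimes\tilde e_ib'$. For $\tilde x_1\in\{\tilde e_1,\tilde f_1\}$, $\tilde x_1$ of a normal monomial $\varphi^{\ast p_n}_{j_n}\cdots\varphi^{\ast p_1}_{j_1}$ is obtained by applying $\tilde x_1$ to $\varphi^{\ast p_n}_{j_n}\otimes\cdots\otimes\varphi^{\ast p_1}_{j_1}$, multiplying out in $\mathcal A$, and dropping the sign; $\tilde x_11=0$. **Restricted paths.** For $n\ge1$, $\mathcal P^k_{res,n}(0,l)$ is the set of $(p_n,\dots,p_1)\in\{0,1\}^n$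 with $(-1)^{p_1}+\cdots+(-1)^{p_s}\in\{0,\dots,k\}$ for $1\le s\le n$ and $(-1)^{p_1}+\cdots+(-1)^{p_n}=l$. $\mathcal P^k_{res,0}(0,0)=\{\emptyset\}$, and $\mathcal P^k_{res,0}(0,l)$ is empty for $l\ne0$. **Path crystal.** For $m\in\{0,\dots,k\}$ let $\bar p_m(i)=m+(k-2m)\epsilon(i)$, $i\in\mathbb Z$; let $\bar p_{m,m'}(i)=\bar p_m(i)$ for $i\ge1$, $=\bar p_{m'}(i)$ for $i\le0$. The path realization identifies $B(\lambda_m)\otimes B(\lambda_{m'})^\ast$ with the set $\mathcal P^{(m,m')}$ of sequences $p=(p(i))_{i\in\mathbb Z}$, $p(i)\in\{0,\dots,k\}$, with $p(i)=\bar p_{m,m'}(i)$ for $|i|\gg0$; the half $i\ge1$ of the path describes the factor in $B(\lambda_m)$ and the half $i\le0$ the factor in $B(\lambda_{m'})^\ast$, so that $B(\lambda_l)\otimes b_{-\lambda_0}$ is the set of $p\in\mathcal P^{(l,0)}$ with $p(i)=\bar p_0(i)$ for all $i\le0$. Each $p\in\mathcal P^{(m,m')}$ corresponds uniquely to data $n\ge0$, walls $l_n\ge\cdots\ge l_1$ in $\mathbb Z$, and a region sequence $(m_n,\dots,m_0)\in\{0,\dots,k\}^{n+1}$ with $m_n=m$, $m_0=m'$, $|m_r-m_{r-1}|=1$, such that $p(i)=\bar p_{m_r}(i)$ for $l_r+1\le i\le l_{r+1}$ (with $l_0=-\infty$, $l_{n+1}=+\infty$; no condition if $l_r=l_{r+1}$),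 and whenever $l_{s+s'}>l_{s+s'-1}=\cdots=l_s>l_{s-1}$ one has $|m_{s+s'-1}-m_{s-1}|=s'$. For a given region sequence the path is written $[[l_n,\dots,l_1]]$; $[[\ ]]$ is the path with no walls. Crystal operators on paths: let $B^{(1)}=\{b_0,b_1\}$ with $\tilde f_1b_0=b_1$, $\tilde e_1b_1=b_0$, $\tilde f_1b_1=\tilde e_1b_0=0$. Put $r_j=1$ if $p(l_j)+p(l_j+1)>k$ and $r_j=0$ if $p(l_j)+p(l_j+1)<k$ (equality does not occur at a wall). If $\tilde x_1(b_{r_n}\otimes\cdots\otimes b_{r_1})=0$ then $\tilde x_1[[l_n,\dots,l_1]]=0$; if $\tilde x_1$ acts on the $j$-th factor $b_{r_j}$, then $\tilde x_1[[l_n,\dots,l_1]]$ is obtained by replacing $l_j$ by $l_j+1$ (for $\tilde f_1$) or $l_j-1$ (for $\tilde e_1$), with the same region sequence. Weights of paths: $wt(p)=(m-m'+2s(p))(\Lambda_1-\Lambda_0)-h(p)\delta$, where $s(p)=\sum_i(\bar p_{m,m'}(i)-p(i))$, $h(p)=\sum_i i\big(\tilde H(p(i+1),p(i))-\tilde H(\bar p_{m,m'}(i+1),\bar p_{m,m'}(i))\big)$, and $\tilde H(a,b)=-b$ if $a+b\le k$, $=a-k$ if $a+b>k$. (Thus the weight of $b\otimes b_{-\lambda_0}$ is $wt(b)-\lambda_0$.) *)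

(* Defs.v *)
(* MathComp, with the classical layer of MathComp-Analysis and the monoid
   algebras of multinomials. *)
From mathcomp Require Import all_boot all_order all_algebra.
From mathcomp Require Import boolp classical_sets functions fsbigop.
From mathcomp Require Import monalg.

Set Implicit Arguments.
Unset Strict Implicit.
Unset Printing Implicit Defensive.

Import GRing.Theory Num.Theory.
Local Open Scope ring_scope.

(* Finite families indexed n, ..., 1 are stored as lists [:: s_n; ...; s_1],
   in the order in which they are written in monomials and tensor products;
   [item x0 s r] is s_r, for 1 <= r <= n. *)
Definition item (T : Type) (x0 : T) (s : seq T) (r : nat) : T :=
  nth x0 (rev s) r.-1.

Definition eps (j : int) : int := (j %% 2)%Z.

(* P = Z Lambda_0 + Z Lambda_1 + Z delta, in coordinates. *)
Definition weight : zmodType := (int * int * int)%type.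
Definition Lambda0 : weight := (1, 0, 0).
Definition Lambda1 : weight := (0, 1, 0).
Definition delta : weight := (0, 0, 1).

(* The operators e~_1, f~_1 of a crystal; [None] is the value 0. *)
Record crystal_ops (T : Type) := CrystalOps {
  et : T -> option T;
  ft : T -> option T
}.

(* max {m : g^m b != 0} *)
Definition max_iter (T : Type) (g : T -> option T) (b : T) : nat :=
  let nonzero m := iter m (obind g) (Some b) <> None in
  xget 0%N [set m | nonzero m /\ forall m', nonzero m' -> (m' <= m)%N].

Definition varepsilon T (C : crystal_ops T) : T -> nat := max_iter (et C).
Definition varphi T (C : crystal_ops T) : T -> nat := max_iter (ft C).

(* C (x) D, where D lives on lists and b (x) s is the list b :: s. *)
Definition tensor_cons T (C : crystal_ops T) (D : crystal_ops (seq T)) :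
    crystal_ops (seq T) :=
  {| et := fun w => if w is b :: s then
         if (varepsilon D s <= varphi C b)%N then omap (cons^~ s) (et C b)
         else omap (cons b) (et D s)
       else None;
     ft := fun w => if w is b :: s then
         if (varepsilon D s < varphi C b)%N then omap (cons^~ s) (ft C b)
         else omap (cons b) (ft D s)
       else None |}.

(* The n-fold tensor power of C, on lists of length n. *)
Fixpoint tensor_pow T (C : crystal_ops T) (n : nat) : crystal_ops (seq T) :=
  if n is n'.+1 then tensor_cons C (tensor_pow C n')
  else {| et := fun=> None; ft := fun=> None |}.

(* An isomorphism of (sl2^)_1 crystals with affine weights, between the
   subset X of (T, C, wtC) and the subset Y of (U, D, wtD).  Both subsets
   have to be stable under the operators. *)
Definition ops_stable T (C : crystal_ops T) (X : set T) : Prop :=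
  forall b c, X b -> et C b = Some c \/ ft C b = Some c -> X c.

Definition crystal_iso T U (C : crystal_ops T) (wtC : T -> weight) (X : set T)
    (D : crystal_ops U) (wtD : U -> weight) (Y : set U) (F : T -> U) : Prop :=
  [/\ ops_stable C X /\ ops_stable D Y,
      set_bij X Y F,
      (forall b, X b -> et D (F b) = omap F (et C b)),
      (forall b, X b -> ft D (F b) = omap F (ft C b)) &
      (forall b, X b -> wtD (F b) = wtC b)].

(* The generator phi^{*p}_j is encoded as (p, j). *)
Definition gen : choiceType := (bool * int)%type.

(* The list [:: x_n; ...; x_1] stands for the monomial x_n ... x_1. *)
Definition word := seq gen.

Definition Hfun (p' p : bool) : nat := p' && ~~ p.
Definition Kfun (p' p : bool) : nat := (1 - Hfun p' p)%N.

Definition free_alg := {malg int[{fmonom gen}]}.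

Definition phi (p : bool) (j : int) : free_alg := << fmu ((p, j) : gen) >>.

Definition word_val (w : word) : free_alg := \prod_(x <- w) phi x.1 x.2.

Definition relator (p2 p1 : bool) (j2 j1 : int) : free_alg :=
  let e := eps (j1 + j2) in
  let j2' := j1 - (2 * Kfun p2 p1)%N%:Z + e in
  let j1' := j2 + (2 * Kfun p2 p1)%N%:Z - e in
  if (j2' == j2) && (j1' == j1) then phi p2 j2 * phi p1 j1
  else phi p2 j2 * phi p1 j1 + phi p2 j2' * phi p1 j1'.

(* The two-sided ideal generated by the relators; the creation algebra is
   the quotient of [free_alg] by this ideal. *)
Inductive rel_ideal : free_alg -> Prop :=
| RelGen p2 p1 j2 j1 : rel_ideal (relator p2 p1 j2 j1)
| RelZero : rel_ideal 0
| RelSub a b : rel_ideal a -> rel_ideal b -> rel_ideal (a - b)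
| RelMulL c a : rel_ideal a -> rel_ideal (c * a)
| RelMulR a c : rel_ideal a -> rel_ideal (a * c).

Definition eqA (a b : free_alg) : Prop := rel_ideal (a - b).

Definition normal_word : pred word :=
  sorted (fun x' x : gen => x.2 + (2 * Hfun x'.1 x.1)%N%:Z <= x'.2).

(* B(p_n, ..., p_1), a normal monomial being represented by its word. *)
Definition Bset (ps : seq bool) : set word :=
  [set w | unzip1 w = ps /\ normal_word w].

Definition Bset_ge0 (ps : seq bool) : set word :=
  [set w | Bset ps w /\
     ((1 <= size w)%N -> 0 <= (item (false, 0) w 1).2)].

(* Value of the monomial w in the creation algebra, up to sign, as 0 or an
   element of B(p_n, ..., p_1). *)
Definition straighten (w : word) : option word :=
  if `[< eqA (word_val w) 0 >] then None
  else Some (xget w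
    [set v | Bset (unzip1 w) v /\
             (eqA (word_val w) (word_val v) \/
              eqA (word_val w) (- word_val v))]).

Definition gen_ops : crystal_ops gen :=
  {| et := fun x => if eps x.2 == 1 then Some (x.1, x.2 - 1) else None;
     ft := fun x => if eps x.2 == 0 then Some (x.1, x.2 + 1) else None |}.

Definition word_ops : crystal_ops word :=
  {| et := fun w => obind straighten (et (tensor_pow gen_ops (size w)) w);
     ft := fun w => obind straighten (ft (tensor_pow gen_ops (size w)) w) |}.

(* For a positive divisor, %/ on int is the floor of the quotient. *)
Definition gen_wt (x : gen) : weight :=
  delta *~ (- (x.2 %/ 2)%Z) + (Lambda1 - Lambda0) *~ (1 - 2 * eps x.2).

Definition word_wt (w : word) : weight := \sum_(x <- w) gen_wt x.

(* (-1)^{p_1} + ... + (-1)^{p_s} *)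
Definition height (ps : seq bool) (s : nat) : int :=
  \sum_(1 <= t < s.+1) (-1) ^+ item false ps t.

(* P^k_{res,n}(0,l); for n = 0 the conditions reduce to l = 0. *)
Definition Pres (k n : nat) (l : int) : set (seq bool) :=
  [set ps | [/\ size ps = n,
     (forall s, (1 <= s <= n)%N -> 0 <= height ps s <= k%:Z) &
     height ps n = l]].

(* The disjoint union over n and P^k_{res,n}(0,l) of the B_{>=0}(p_n,...,p_1);
   it is disjoint since a word determines its upper indices. *)
Definition restricted_words (k : nat) (l : int) : set word :=
  [set w | exists n ps, Pres k n l ps /\ Bset_ge0 ps w].

Definition pathT := int -> int.

Definition pbar (k : nat) (m : int) : pathT :=
  fun i => m + (k%:Z - 2 * m) * eps i.

Definition pbar2 (k : nat) (m m' : int) : pathT :=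
  fun i => if 1 <= i then pbar k m i else pbar k m' i.

Definition path_set (k : nat) (m m' : int) : set pathT :=
  [set p | (forall i, 0 <= p i <= k%:Z) /\
           (exists N : nat, forall i, N%:Z < `|i| -> p i = pbar2 k m m' i)].

(* Walls [:: l_n; ...; l_1] and regions [:: m_n; ...; m_0]. *)
Definition wall_data := (seq int * seq int)%type.

(* The regions being indexed from 0, m_s is the entry of index s + 1. *)
Definition wall (d : wall_data) (s : nat) : int := item 0 d.1 s.
Definition region (d : wall_data) (s : nat) : int := item 0 d.2 s.+1.

Definition admissible (k : nat) (m m' : int) (d : wall_data) : Prop :=
  let n := size d.1 in
  [/\ size d.2 = n.+1 /\ (forall r, (r <= n)%N -> 0 <= region d r <= k%:Z),
      region d n = m /\ region d 0 = m',
      (forall r, (1 <= r <= n)%N -> `|region d r - region d r.-1| = 1),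
      (forall r, (1 <= r < n)%N -> wall d r <= wall d r.+1) &
      (* l_{s+s'} > l_{s+s'-1} = ... = l_s > l_{s-1}, where l_0 = -oo and
         l_{n+1} = +oo *)
      (forall s s', (1 <= s)%N -> (1 <= s')%N -> (s + s' <= n.+1)%N ->
         ((s + s' <= n)%N -> wall d (s + s').-1 < wall d (s + s')) ->
         (forall t, (s <= t < s + s')%N -> wall d t = wall d s) ->
         ((1 < s)%N -> wall d s.-1 < wall d s) ->
         `|region d (s + s').-1 - region d s.-1| = s'%:Z)].

(* The path [[l_n, ..., l_1]]: as the walls are weakly ordered, the r with
   l_r + 1 <= i <= l_{r+1} is the number of walls smaller than i. *)
Definition path_of (k : nat) (d : wall_data) : pathT :=
  fun i => pbar k (region d (count (fun l => l < i) d.1)) i.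

(* The unique data of a path of P^(m,m'). *)
Definition data_of (k : nat) (m m' : int) (p : pathT) : wall_data :=
  xget ([::], [::]) [set d | admissible k m m' d /\ path_of k d = p].

(* B^(1), with b_0 = false and b_1 = true. *)
Definition B1_ops : crystal_ops bool :=
  {| et := fun b => if b then Some false else None;
     ft := fun b => if b then None else Some true |}.

Definition wall_bit (k : nat) (p : pathT) (l : int) : bool :=
  k%:Z < p l + p (l + 1).

(* Shift by c the wall at the position where the tensors r and r' differ. *)
Definition move_wall (c : int) (r r' : seq bool) (ls : seq int) : seq int :=
  [seq if x.1.1 == x.1.2 then x.2 else x.2 + c | x <- zip (zip r r') ls].

Definition path_op (k : nat) (m m' : int) (c : int)
    (x1 : crystal_ops (seq bool) -> seq bool -> option (seq bool))
    (p : pathT) : option pathT :=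
  let d := data_of k m m' p in
  let r := [seq wall_bit k p l | l <- d.1] in
  omap (fun r' => path_of k (move_wall c r r' d.1, d.2))
       (x1 (tensor_pow B1_ops (size r)) r).

Definition path_ops (k : nat) (m m' : int) : crystal_ops pathT :=
  {| et := path_op k m m' (-1) (@et _);
     ft := path_op k m m' 1 (@ft _) |}.

Definition Htilde (k : nat) (a b : int) : int :=
  if a + b <= k%:Z then - b else a - k%:Z.

(* The sums over Z are finitely supported on P^(m,m'). *)
Definition path_s (k : nat) (m m' : int) (p : pathT) : int :=
  \sum_(i \in [set: int]) (pbar2 k m m' i - p i).

Definition path_h (k : nat) (m m' : int) (p : pathT) : int :=
  \sum_(i \in [set: int])
    (i * (Htilde k (p (i + 1)) (p i) -
          Htilde k (pbar2 k m m' (i + 1)) (pbar2 k m m' i))).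

Definition path_wt (k : nat) (m m' : int) (p : pathT) : weight :=
  (Lambda1 - Lambda0) *~ (m - m' + 2 * path_s k m m' p)
  - delta *~ path_h k m m' p.

(* B(lambda_l), realized as B(lambda_l) (x) b_{-lambda_0} in P^(l,0). *)
Definition Blambda (k : nat) (l : int) : set pathT :=
  [set p | path_set k l 0 p /\ forall i, i <= 0 -> p i = pbar k 0 i].

(* j_n - p_n, ..., j_1 - p_1, with region sequence m_s = height s. *)
Definition word_data (w : word) : wall_data :=
  ([seq x.2 - (nat_of_bool x.1)%:Z | x : gen <- w],
   rev [seq height (unzip1 w) s | s <- iota 0 (size w).+1]).

Definition word_path (k : nat) (w : word) : pathT := path_of k (word_data w).

(* Main.v *)
(* A relation exchanges, up to sign, two neighbours of a monomial.  Record the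
   parities of the j_r separately and write b_r = floor(j_r / 2) + d_r, with d
   depending only on the upper indices and the parities: in these coordinates
   the relations say that a monomial is antisymmetric in b, and a monomial is
   normal iff b is strictly decreasing from left to right.  The sign of the
   permutation sorting b then gives a functional on the free algebra which
   kills the relations and separates the normal monomials, so a normal monomial
   is its own straightening.

   Under the signature rule e~_1 and f~_1 send normal words to normal words,
   hence no straightening occurs, and both sides carry the same tensor product
   of two-element crystals: the bit of the wall of a generator is the parity
   of j.

   In terms of the walls l = j - p, a normal word is a weakly ordered sequence
   of walls in which equal walls have equal signs.  It is therefore determined
   by its height function, whose jump at i is the signed number of walls at i,
   and every path is the path of its height function.  Both weights are sums of
   contributions of the single walls. *)

Require Import Defs.
From mathcomp Require Import all_boot all_order all_algebra.
From mathcomp Require Import boolp classical_sets functions fsbigop.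
From mathcomp Require Import finmap monalg zify ring.

Set Implicit Arguments.
Unset Strict Implicit.
Unset Printing Implicit Defensive.

Import Order.TTheory GRing.Theory Num.Theory.
Local Open Scope ring_scope.

(** * Linear independence of the normal monomials *)

Definition oddz (j : int) : bool := eps j == 1.

Lemma oddzE (j : int) : j = 2 * (j %/ 2)%Z + (oddz j)%:Z.
Proof. rewrite /oddz /eps; case: eqP => /=; lia. Qed.

Lemma eps_oddz (j : int) : eps j = (oddz j)%:Z.
Proof. rewrite /oddz /eps; case: eqP => /=; lia. Qed.

Definition label := (bool * bool)%type.
Definition lab (x : gen) : label := (x.1, oddz x.2).

(* The increment d_{r+1} - d_r, for the labels [a'] = r+1 and [a] = r. *)
Definition lab_shift (a' a : label) : int :=
  (Kfun a'.1 a.1)%:Z - (~~ a'.2 && a.2)%:Z.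

(** The offset d of the leftmost letter, normalised to 0 at the right end of the word; it depends
    only on the labels from that letter to the right. *)
Fixpoint total_shift (s : seq label) : int :=
  if s is a' :: t then
    (if t is a :: _ then lab_shift a' a + total_shift t else 0)
  else 0.

Fixpoint bseq (w : word) : seq int :=
  if w is x :: t then ((x.2 %/ 2)%Z + total_shift (map lab w)) :: bseq t
  else [::].

(** The entries belonging to [u] see the letters of [v] only through their labels. *)
Lemma bseq_catl (u v v' : word) : map lab v = map lab v' ->
  exists t, bseq (u ++ v) = t ++ bseq v /\ bseq (u ++ v') = t ++ bseq v'.
Proof.
move=> e; elim: u => [|x u [t [IH1 IH2]]]; first by exists [::].
exists (((x.2 %/ 2)%Z + total_shift (map lab (x :: u ++ v))) :: t).
by split; rewrite cat_cons /= ?IH1 ?IH2 // !map_cat e.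
Qed.

(** Adding [e] gives [j1] the parity of [j2], so each position keeps its parity, while the floors of
    the halves are exchanged up to the difference of offsets. *)
Lemma swap_labels (p2 p1 : bool) (j2 j1 : int) :
  let e := eps (j1 + j2) in
  let K := (2 * Kfun p2 p1)%N%:Z in
  [/\ oddz (j1 - K + e) = oddz j2, oddz (j2 + K - e) = oddz j1,
      ((j1 - K + e) %/ 2)%Z + lab_shift (lab (p2, j2)) (lab (p1, j1))
        = (j1 %/ 2)%Z &
      ((j2 + K - e) %/ 2)%Z =
        (j2 %/ 2)%Z + lab_shift (lab (p2, j2)) (lab (p1, j1))].
Proof.
rewrite /lab_shift /lab /= PoszM.
set c := (Kfun p2 p1)%:Z.
move: (oddzE j1) (oddzE j2).
rewrite /oddz /eps; case: eqP => h1; case: eqP => h2 /= h3 h4; split; try lia;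
  by case: eqP; case: eqP => //; lia.
Qed.

Lemma bseq_swap (u v : word) (p2 p1 : bool) (j2 j1 : int) :
  let e := eps (j1 + j2) in
  let K := (2 * Kfun p2 p1)%N%:Z in
  let w := u ++ (p2, j2) :: (p1, j1) :: v in
  let w' := u ++ (p2, j1 - K + e) :: (p1, j2 + K - e) :: v in
  map lab w = map lab w' /\
  exists s t b2 b1, bseq w = s ++ b2 :: b1 :: t /\ bseq w' = s ++ b1 :: b2 :: t.
Proof.
move=> e K w w'; have [o2 o1 h2 h1] := swap_labels p2 p1 j2 j1.
have el : map lab ((p2, j2) :: (p1, j1) :: v) =
          map lab ((p2, j1 - K + e) :: (p1, j2 + K - e) :: v).
  by rewrite /= /lab /= o1 o2.
split; first by rewrite !map_cat el.
have [s [e1 e2]] := bseq_catl u el.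
exists s, (bseq v),
  ((j2 %/ 2)%Z + total_shift (map lab ((p2, j2) :: (p1, j1) :: v))),
  ((j1 %/ 2)%Z + total_shift (map lab ((p1, j1) :: v))).
have el' : map lab ((p1, j1) :: v) = map lab ((p1, j2 + K - e) :: v).
  by rewrite /= /lab /= o1.
split; first by rewrite e1.
have -> : bseq w' = s ++ bseq ((p2, j1 - K + e) :: (p1, j2 + K - e) :: v).
  by rewrite -e2.
congr (s ++ _).
have bc x t : bseq (x :: t) =
   ((x.2 %/ 2)%Z + total_shift (map lab (x :: t))) :: bseq t by [].
rewrite 2!bc -el -el' /= h1 -h2 -/e -/K.
by rewrite !addrA.
Qed.

(** Inversions are counted against the decreasing order, which is the order of the b-sequence of a
    normal word. *)
Fixpoint inv (s : seq int) : nat :=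
  if s is x :: t then (count (> x) t + inv t)%N else 0%N.

Lemma inv_swap s t (a b : int) : a != b ->
  odd (inv (s ++ a :: b :: t)) = ~~ odd (inv (s ++ b :: a :: t)).
Proof.
move=> ab; elim: s => [|x s IH] /=.
  rewrite !oddD !oddb; case: (ltrgtP a b) ab => //= _ _;
    by move: (odd (count (> a) t)) (odd (count (> b) t)) (odd (inv t));
      do 3!case.
rewrite !oddD IH !count_cat /= !oddD !oddb -addbN.
by rewrite (addbCA (x < a)).
Qed.

Lemma inv_sorted s : sorted >%R s -> inv s = 0%N.
Proof.
have tr : transitive (fun x y : int => x > y).
  by move=> y x z h1 h2; exact: lt_trans h2 h1.
elim: s => //= x s IH h; rewrite IH ?(path_sorted h) // addn0.
apply/eqP; rewrite -leqn0 leqNgt -has_count; apply/hasPn => y ys.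
move: h; rewrite (path_sortedE tr) => /andP[/allP /(_ _ ys) h _].
by rewrite -leNgt ltW.
Qed.

(* Coefficient of the normal monomial with labels [L] and b-sequence [B]. *)
Definition word_coef (L : seq label) (B : seq int) (w : seq gen) : int :=
  if (map lab w == L) && perm_eq (bseq w) B then (-1) ^+ odd (inv (bseq w))
  else 0.

(** If the coefficient is nonzero, [uniq B] makes the two exchanged entries distinct, and exchanging
    them reverses the sign. *)
Lemma word_coef_swap L B (u v : word) (p2 p1 : bool) (j2 j1 : int) :
  uniq B ->
  let e := eps (j1 + j2) in
  let K := (2 * Kfun p2 p1)%N%:Z in
  let w := u ++ (p2, j2) :: (p1, j1) :: v in
  let w' := u ++ (p2, j1 - K + e) :: (p1, j2 + K - e) :: v in
  word_coef L B w + word_coef L B w' = 0.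
Proof.
move=> uB e K w w'; rewrite /word_coef.
have [<- [s [t [b2 [b1 [-> ->]]]]]] := bseq_swap u v p2 p1 j2 j1.
case: eqP => //= _.
have pe : perm_eq (s ++ b2 :: b1 :: t) (s ++ b1 :: b2 :: t).
  by rewrite perm_cat2l; exact/permPl/(perm_catCA [:: b2] [:: b1]).
rewrite -(permPl pe).
case: ifP => // pB; rewrite (@inv_swap s t b2 b1).
  by case: (odd _).
move: uB; rewrite -(perm_uniq pB) cat_uniq /= inE.
by case/and3P=> _ _ /andP[]; rewrite negb_or => /andP[].
Qed.

Definition coef (L : seq label) (B : seq int) : free_alg -> int :=
  mmap idfun (fun m : {fmonom gen} => word_coef L B m).

Lemma word_val_cat (u v : word) : word_val (u ++ v) = word_val u * word_val v.
Proof. exact: big_cat. Qed.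

Lemma word_val_cons x w : word_val (x :: w) = phi x.1 x.2 * word_val w.
Proof. exact: big_cons. Qed.

Lemma word_valE (w : word) : word_val w = << FMonom w >>.
Proof.
elim: w => [|x w IH]; first by rewrite /word_val big_nil -fmoneE.
rewrite /word_val big_cons -/(word_val w) IH /phi -surjective_pairing.
by rewrite malgM_def /= fgmulUU mulr1; congr (<< _ >>);
  rewrite /mmul /= fmmulE fmuE.
Qed.

Lemma malg_words (c : free_alg) :
  c = \sum_(m <- msupp c) word_val m *~ c@_m.
Proof.
rewrite {1}[c]monalgE; apply: eq_bigr => m _.
by rewrite word_valE fmK -(raddfMz (mkmalgU m)) intz.
Qed.

Lemma coef_word L B (w : word) : coef L B (word_val w) = word_coef L B w.
Proof. by rewrite word_valE /coef mmapU mul1r. Qed.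

Lemma coefD L B a b : coef L B (a + b) = coef L B a + coef L B b.
Proof. exact: raddfD. Qed.

Lemma coefB L B a b : coef L B (a - b) = coef L B a - coef L B b.
Proof. exact: raddfB. Qed.

Lemma coef_relator L B (u v : word) p2 p1 j2 j1 : uniq B ->
  coef L B (word_val u * relator p2 p1 j2 j1 * word_val v) = 0.
Proof.
move=> uB; have d0 (x : int) : x + x = 0 -> x = 0 by lia.
have e2 i2 i1 : word_val u * (phi p2 i2 * phi p1 i1) * word_val v =
    word_val (u ++ (p2, i2) :: (p1, i1) :: v).
  by rewrite word_val_cat !word_val_cons -mulrA -(mulrA (phi p2 i2)).
have := @word_coef_swap L B u v p2 p1 j2 j1 uB; rewrite /relator /=.
move: (j1 - _ + _) (j2 + _ - _) => i2 i1.
(* If the two monomials coincide, the exchange identity reads c + c = 0, hence c = 0 in the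
   integers. *)
case: ifP => [/andP[/eqP -> /eqP ->]|_] h.
  by rewrite e2 coef_word; exact: d0.
rewrite -h -2!coef_word -2!e2.
rewrite -coefD.
by congr (coef L B _); rewrite mulrDr; exact: mulrDl.
Qed.

(* Stated in an abstract ring, where [*%R] cannot be unfolded. *)
Lemma sandwich_span (R : nzRingType) (V : zmodType) (f : {additive R -> V})
    (I J : Type) (r : seq I) (s : seq J) (x : I -> R) (y : J -> R)
    (m : I -> int) (n : J -> int) (a : R) :
  (forall i j, f (x i * a * y j) = 0) ->
  f ((\sum_(i <- r) x i *~ m i) * a * (\sum_(j <- s) y j *~ n j)) = 0.
Proof.
move=> f0; rewrite !mulr_suml raddf_sum big1 // => i _.
rewrite mulr_sumr raddf_sum big1 // => j _.
by rewrite !mulrzAl mulrzAr !raddfMz /= f0 !mul0rz.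
Qed.

Lemma sandwich_mull (R : nzRingType) (V : zmodType) (f : {additive R -> V})
    (e a : R) :
  (forall c d, f (c * a * d) = 0) -> forall c d, f (c * (e * a) * d) = 0.
Proof. by move=> f0 c d; rewrite mulrA f0. Qed.

Lemma sandwich_mulr (R : nzRingType) (V : zmodType) (f : {additive R -> V})
    (a e : R) :
  (forall c d, f (c * a * d) = 0) -> forall c d, f (c * (a * e) * d) = 0.
Proof. by move=> f0 c d; rewrite mulrA -mulrA f0. Qed.

Lemma sandwich_sub (R : nzRingType) (V : zmodType) (f : {additive R -> V})
    (a b : R) :
  (forall c d, f (c * a * d) = 0) -> (forall c d, f (c * b * d) = 0) ->
  forall c d, f (c * (a - b) * d) = 0.
Proof.
by move=> fa fb c d; rewrite mulrBr mulrBl raddfB fa fb subr0.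
Qed.

Lemma sandwich0 (R : nzRingType) (V : zmodType) (f : {additive R -> V}) :
  forall c d, f (c * 0 * d) = 0.
Proof. by move=> c d; rewrite mulr0 mul0r raddf0. Qed.

(** Vanishing on all two-sided multiples of [a], unlike vanishing at [a] alone, is stable under each
    rule that generates the ideal. *)
Lemma coef_ideal L B a : uniq B -> rel_ideal a ->
  forall c d, coef L B (c * a * d) = 0.
Proof.
move=> uB; elim=> {a} [p2 p1 j2 j1|| a b _ IHa _ IHb | e a _ IHa | a e _ IHa].
- move=> c d; rewrite (malg_words c) (malg_words d).
  by apply: (sandwich_span (f := coef L B)) => m m'; exact: coef_relator.
- exact: (sandwich0 (coef L B)).
- exact: (sandwich_sub (f := coef L B) IHa IHb).
- exact: (sandwich_mull (f := coef L B) e IHa).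
- exact: (sandwich_mulr (f := coef L B) e IHa).
Qed.

Lemma coef_ideal0 L B a : uniq B -> rel_ideal a -> coef L B a = 0.
Proof.
move=> uB h; have /= := coef_ideal L uB h 1 1.
by rewrite [_ * 1]mulr1 [1 * a]mul1r.
Qed.

Lemma normal_step (x' x : gen) t :
  (x.2 + (2 * Hfun x'.1 x.1)%N%:Z <= x'.2) =
  ((x'.2 %/ 2)%Z + total_shift (map lab (x' :: x :: t)) >
   (x.2 %/ 2)%Z + total_shift (map lab (x :: t))).
Proof.
case: x' x => [[] j'] [[] j]; rewrite /= /lab_shift /Kfun /Hfun /=;
(* The offset of [x] is common to both sides; only the step from [x] to [x'] matters. *)
move: (match map lab t with [::] => 0 | _ => _ end) => T;
rewrite /oddz /eps; case: eqP; case: eqP => /=; lia.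
Qed.

Lemma normal_bseq w : normal_word w = sorted >%R (bseq w).
Proof.
case: w => // x w; elim: w x => // y w IH x.
exact: (congr2 andb (normal_step x y w) (IH y)).
Qed.

(** A decreasing sequence has no inversions and is determined by its multiset. The labels fix all
    offsets, so the b-sequence gives back each floor(j/2), and the parity then gives j. *)
Lemma word_coef_normal (w v : word) : normal_word w -> normal_word v ->
  word_coef (map lab w) (bseq w) v = (v == w)%:R.
Proof.
rewrite !normal_bseq => nw nv; rewrite /word_coef.
case: (eqVneq v w) => [->|vw]; first by rewrite eqxx perm_refl inv_sorted.
case: ifP => // /andP[/eqP el pe]; case/eqP: vw.
have eb : bseq v = bseq w.
  apply: (@sorted_eq _ >%R) => //.
  - by move=> y x z h1 h2; exact: lt_trans h2 h1.
  - by move=> x y /andP[h1 h2]; have := lt_trans h1 h2; rewrite ltxx.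
elim: v w el eb {nw nv pe} => [|[p j] v IH] [|[q i] w] //= [-> eo el] [ej eb].
have ev := IH w el eb; subst v; rewrite /lab /= eo in ej.
by rewrite (oddzE j) (oddzE i) eo (addIr _ ej).
Qed.

(** The functional attached to [w] is 1 at [w] and 0 at every other normal word, so in the algebra
    [w] is neither 0 nor plus or minus another normal word. *)
Lemma straighten_normal w : normal_word w -> straighten w = Some w.
Proof.
move=> nw; rewrite /straighten.
have uB : uniq (bseq w).
  move: nw; rewrite normal_bseq; apply: sorted_uniq.
    by move=> y x z h1 h2; exact: lt_trans h2 h1.
  by move=> x; rewrite /= ltxx.
case: asboolP => [h|_].
  by have := coef_ideal0 (map lab w) uB h;
    rewrite subr0 coef_word word_coef_normal // eqxx.
congr Some; case: xgetP => [v _ [[_ nv] h]|/(_ w)[]].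
  apply/eqP; apply: contraT => vw.
  by case: h => /(coef_ideal0 (map lab w) uB); rewrite ?opprK ?coefB ?coefD
    !coef_word !word_coef_normal // eqxx (negbTE vw).
split; first by [].
by left; rewrite /eqA subrr; exact: RelZero.
Qed.

(** * The signature rule on normal words *)

Lemma iter_obind_None T (g : T -> option T) m : iter m (obind g) None = None.
Proof. by elim: m => //= m ->. Qed.

(** The measure [mu] bounds the nonzero iterates, so the maximum exists and [xget] does not fall
    back on its default 0. *)
Lemma max_iter_eq0 T (g : T -> option T) (mu : T -> nat) b :
  (forall x y, g x = Some y -> (mu y < mu x)%N) ->
  (max_iter g b == 0%N) = ~~ isSome (g b).
Proof.
move=> gmu.
have bd m : iter m (obind g) (Some b) <> None -> (m <= mu b)%N.
  elim: m b => // m IH x; rewrite iterSr /=.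
  case gx: (g x) => [y|]; rewrite ?iter_obind_None // => nz.
  exact: (leq_ltn_trans (IH y nz) (gmu x y gx)).
pose P m := `[< iter m (obind g) (Some b) <> None >].
have exP : exists m, P m by exists 0%N; apply/asboolP.
have [m Pm maxm] := ex_maxnP exP (fun m Pm => bd m (asboolW Pm)).
rewrite /max_iter; case: xgetP => [M _ [nzM maxM]|/(_ m)[]]; last first.
  by split=> [|m' nz]; [exact: asboolW | apply/maxm/asboolP].
case gb: (g b) => [y|] /=.
  by apply/negbTE; rewrite -lt0n; apply: maxM; rewrite /= gb.
by case: M nzM {maxM} => // M; rewrite iterSr /= gb iter_obind_None.
Qed.

(** The same exponents give nonzero iterates on both sides, so the two values agree even if no
    maximum exists. *)
Lemma max_iter_morph T U (f : T -> U) g h b :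
  (forall x, h (f x) = omap f (g x)) -> max_iter h (f b) = max_iter g b.
Proof.
move=> fgh; have E m : (iter m (obind h) (Some (f b)) <> None) =
                       (iter m (obind g) (Some b) <> None).
  have -> : iter m (obind h) (Some (f b)) =
            omap f (iter m (obind g) (Some b)).
    by elim: m => //= m ->; case: (iter _ _ _) => //= x; rewrite fgh.
  by apply/propext; case: (iter _ _ _).
rewrite /max_iter; congr (xget _ _); apply/seteqP; split=> m /=;
  by rewrite ?E => -[nz mx]; split; rewrite ?E // => m'; have := mx m';
    rewrite E.
Qed.

(** The signature rule reads the factors only through their string lengths, which [f] preserves. It
    is meant for the parity map from generators to [B1_ops]. *)
Lemma tensor_pow_morph T U (C : crystal_ops T) (D : crystal_ops U)
    (f : T -> U) :
  (forall x, et D (f x) = omap f (et C x)) ->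
  (forall x, ft D (f x) = omap f (ft C x)) -> forall n w,
  et (tensor_pow D n) (map f w) = omap (map f) (et (tensor_pow C n) w) /\
  ft (tensor_pow D n) (map f w) = omap (map f) (ft (tensor_pow C n) w).
Proof.
move=> fe ff; elim=> // n IH [|b s] //=.
have -> : varphi D (f b) = varphi C b by exact: max_iter_morph.
have -> : varepsilon (tensor_pow D n) (map f s) = varepsilon (tensor_pow C n) s.
  by apply: max_iter_morph => w; have [] := IH w.
have [-> ->] := IH s; rewrite fe ff.
by split; case: ifP => _;
  [case: (et C b)|case: (et _ s)|case: (ft C b)|case: (ft _ s)].
Qed.

Lemma gen_etP x y : et gen_ops x = Some y -> oddz x.2 /\ y = (x.1, x.2 - 1).
Proof. by rewrite /= /oddz; case: eqP => // _ [<-]. Qed.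

Lemma gen_ftP x y : ft gen_ops x = Some y -> ~~ oddz x.2 /\ y = (x.1, x.2 + 1).
Proof. by rewrite /= /oddz; case: eqP => // -> [<-]. Qed.

Lemma oddzD1 j : oddz (j + 1) = ~~ oddz j.
Proof. by rewrite /oddz /eps; case: eqP; case: eqP; lia. Qed.

Lemma oddzB1 j : oddz (j - 1) = ~~ oddz j.
Proof. by rewrite -{2}(subrK 1 j) oddzD1 negbK. Qed.

Lemma varphi_gen x : (0 < varphi gen_ops x)%N = ~~ oddz x.2.
Proof.
rewrite lt0n (@max_iter_eq0 _ _ (fun y => ~~ oddz y.2 : nat)).
  by rewrite negbK /= /oddz eps_oddz; case: (oddz _).
by move=> {}x y /gen_ftP[ox ->] /=; rewrite oddzD1 ox.
Qed.

Lemma varphi_gen_le1 x : (varphi gen_ops x <= 1)%N.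
Proof.
rewrite /varphi /max_iter; case: xgetP => // -[|[|m]] // _ [nz _].
case: nz; rewrite !iterSr.
suff -> : obind (ft gen_ops) (obind (ft gen_ops) (Some x)) = None.
  exact: iter_obind_None.
case fx: (obind _ (Some x)) => [y|] //; have [ox ->] := gen_ftP fx.
case fy: (obind _ _) => [z|] //; have [] := gen_ftP fy.
by rewrite /= oddzD1 ox.
Qed.

(** The number of odd letters is the measure that bounds the iterates of e~. *)
Lemma tensor_et_odd n w w' : et (tensor_pow gen_ops n) w = Some w' ->
  (count (fun x : gen => oddz x.2) w' < count (fun x : gen => oddz x.2) w)%N.
Proof.
elim: n w w' => // n IH [|b s] w' //=; case: ifP => _.
  case eb: (if _ then _ else _) => [c|] // [<-] /=.
  by have [-> ->] := gen_etP eb; rewrite /= oddzB1 ltn_add2r;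
    case: (oddz b.2) (gen_etP eb) => // -[].
by case es: (et _ s) => [t|] // [<-] /=; rewrite ltn_add2l IH.
Qed.

Lemma tensor_varepsilon_eq0 n w :
  (varepsilon (tensor_pow gen_ops n) w == 0%N) =
  ~~ isSome (et (tensor_pow gen_ops n) w).
Proof. exact: max_iter_eq0 (@tensor_et_odd n). Qed.

(* In the signature rule f~ acts on the leftmost unmatched even generator. *)
Lemma tensor_ftP n w w' : ft (tensor_pow gen_ops n) w = Some w' ->
  exists u x v, [/\ w = u ++ x :: v, w' = u ++ (x.1, x.2 + 1) :: v,
    ~~ oddz x.2 & forall u' y, u = rcons u' y -> oddz y.2].
Proof.
elim: n w w' => // n IH [|b s] w' //.
rewrite [ft _ _]/=; case: ifP => [_|e].
  case fb: (if _ then _ else _) => [c|] // [<-].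
  have [ob ->] := gen_ftP fb.
  by exists [::], b, s; split=> // u' y; case: u'.
case fs: (ft _ s) => [t|] // [<-].
have [u [x [v [es est ox hu]]]] := IH _ _ fs; subst t.
exists (b :: u), x, v; split=> // [|u' y]; first by rewrite es.
case/lastP: u es fs hu => [|u z] es fs hu; last first.
  by rewrite -rcons_cons => /rcons_inj[_ <-]; exact: (hu u).
case: u' => [|? []] // [<-].
(* If [b] were even, e~ would be nonzero on [s], since f~ passes over [b]. But f~ acts on the even
   head [x] of [s], and then e~ is 0 on [s]. *)
apply/negPn/negP => ob; move/negbT: e; rewrite -leqNgt.
have vb : (0 < varphi gen_ops b)%N by rewrite varphi_gen.
move=> le; have := leq_trans vb le; rewrite lt0n tensor_varepsilon_eq0 negbK.
case: n fs {IH le} => [|n] //; rewrite {}es /=.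
have vx : (0 < varphi gen_ops x)%N by rewrite varphi_gen.
have vx1 := varphi_gen_le1 x.
case: ifP => [lt _|_]; last first.
  by case: (ft _ v) => // a /Some_inj/(congr1 (fun t : word => (head x t).2))
    /=; lia.
have -> : eps x.2 == 1 = false by apply/negbTE.
by rewrite ltnW.
Qed.

(** Here e~ acts on the rightmost unmatched odd generator; an odd right neighbour would be unmatched
    as well. *)
Lemma tensor_etP n w w' : size w = n -> et (tensor_pow gen_ops n) w = Some w' ->
  exists u x v, [/\ w = u ++ x :: v, w' = u ++ (x.1, x.2 - 1) :: v,
    oddz x.2 & forall y v', v = y :: v' -> ~~ oddz y.2].
Proof.
elim: n w w' => // n IH [|b s] w' // [sz].
rewrite [et _ _]/=; case: ifP => [e|_]; last first.
  case fs: (et _ s) => [t|] // [<-].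
  have [u [x [v [-> -> ox hv]]]] := IH _ _ sz fs.
  by exists (b :: u), x, v; split.
case fb: (if _ then _ else _) => [c|] // [<-].
have [ob ->] := gen_etP fb.
exists [::], b, s; split=> // y v ev.
have vb : varphi gen_ops b = 0%N.
  by apply/eqP; rewrite -leqn0 leqNgt varphi_gen ob.
subst s; move: e; rewrite vb leqn0 tensor_varepsilon_eq0.
case: n {IH fb} sz => [|n] // _; rewrite [et _ _]/=.
case: ifP => [_|/negbT].
  by rewrite /= /oddz; case: eqP.
rewrite -ltnNge => /(leq_ltn_trans (leq0n _)).
by rewrite lt0n tensor_varepsilon_eq0 negbK; case: (et _ v).
Qed.

Lemma normal_modify u x y v : y.1 = x.1 -> normal_word (u ++ x :: v) ->
  (forall u' z, u = rcons u' z ->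
    x.2 + (2 * Hfun z.1 x.1)%N%:Z <= z.2 ->
    y.2 + (2 * Hfun z.1 x.1)%N%:Z <= z.2) ->
  (forall z v', v = z :: v' ->
    z.2 + (2 * Hfun x.1 z.1)%N%:Z <= x.2 ->
    z.2 + (2 * Hfun x.1 z.1)%N%:Z <= y.2) ->
  normal_word (u ++ y :: v).
Proof.
move=> e1; rewrite /normal_word !sorted_cat_cons => /andP[hu hv] lu lv.
apply/andP; split.
  case/lastP: u hu lu => [|u z] // hu lu; move: hu.
  rewrite -!cats1 -!catA /= !sorted_cat_cons /= !andbT => /andP[-> h] /=.
  by rewrite e1; exact: (lu u z).
case: v hv lv => [|z v] //= /andP[h ->] lv; rewrite andbT e1; exact: (lv z v).
Qed.

Lemma oddz_ge1 (j : int) : oddz j -> 0 <= j -> 0 <= j - 1.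
Proof. by move=> oj; move: (oddzE j); rewrite oj; lia. Qed.

(** For different parities the inequality of normality is strict, which leaves room for a shift by
    1. *)
Lemma oddz_gap (i j : int) (h : nat) : oddz i != oddz j ->
  i + (2 * h)%N%:Z <= j -> i + 1 + (2 * h)%N%:Z <= j.
Proof.
by move: (oddzE i) (oddzE j); case: (oddz i); case: (oddz j) => //=; lia.
Qed.

(** Raising an even letter only helps against its right neighbour, and its left neighbour is odd, so
    the gap there has room. *)
Lemma tensor_ft_normal n w w' : normal_word w ->
  ft (tensor_pow gen_ops n) w = Some w' -> normal_word w'.
Proof.
move=> nw /tensor_ftP[u [x [v [ew -> ox hu]]]]; subst w.
apply: normal_modify nw _ _ => //= [u' z /hu|z v' _]; last by lia.
by move=> oz; apply: oddz_gap; rewrite (negbTE ox) oz.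
Qed.

Lemma tensor_et_normal w w' : normal_word w ->
  et (tensor_pow gen_ops (size w)) w = Some w' -> normal_word w'.
Proof.
move=> nw /tensor_etP[] // u [x [v [ew -> ox hv]]]; subst w.
apply: normal_modify nw _ _ => //= [u' z _|z v' /hv]; first by lia.
by move=> oz h; rewrite lerBrDr addrAC; apply: oddz_gap h;
  rewrite ox (negbTE oz).
Qed.

Lemma word_ops_et w : normal_word w ->
  et word_ops w = et (tensor_pow gen_ops (size w)) w.
Proof.
move=> nw; rewrite /word_ops [LHS]/=.
case ew: (et _ w) => [w'|] //=.
by rewrite straighten_normal // (tensor_et_normal nw ew).
Qed.

Lemma word_ops_ft w : normal_word w ->
  ft word_ops w = ft (tensor_pow gen_ops (size w)) w.
Proof.
move=> nw; rewrite /word_ops [LHS]/=.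
case ew: (ft _ w) => [w'|] //=.
by rewrite straighten_normal // (tensor_ft_normal nw ew).
Qed.

Lemma item1 w : item (false, 0) w 1 = last ((false, 0) : gen) w.
Proof.
by rewrite /item; case/lastP: w => // w x; rewrite rev_rcons last_rcons.
Qed.

Lemma restricted_words_stable k l :
  ops_stable word_ops (restricted_words k l).
Proof.
move=> w w' [n [ps [pw [[ups nw] ge]]]] h.
suff [u1 nw' ge'] : [/\ unzip1 w' = unzip1 w, normal_word w' &
    (1 <= size w')%N -> 0 <= (item (false, 0) w' 1).2].
  by exists n, ps; split=> //; split=> //; split=> //; rewrite u1.
case: h => h.
  rewrite word_ops_et // in h; rewrite (tensor_et_normal nw h).
  have [//|u [x [v [ew ew' ox _]]]] := tensor_etP _ h; subst w w'.
  split=> //; first by rewrite /unzip1 !map_cat.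
  move: ge; rewrite !item1 !last_cat !size_cat /= !addnS => /(_ isT).
  case: v {nw h ups} => //= x0 _.
  exact: oddz_ge1.
rewrite word_ops_ft // in h; rewrite (tensor_ft_normal nw h).
have [u [x [v [ew ew' ox _]]]] := tensor_ftP h; subst w w'.
split=> //; first by rewrite /unzip1 !map_cat.
move: ge; rewrite !item1 !last_cat !size_cat /= !addnS => /(_ isT).
by case: v {nw h ups} => //= x0 _; exact: addr_ge0.
Qed.

(** * Walls and heights *)

Definition wl (x : gen) : int := x.2 - (x.1 : nat)%:Z.
Definition sgx (x : gen) : int := (-1) ^+ x.1.
Definition tot (w : word) : int := \sum_(x <- w) sgx x.
(** For a normal word, the region that contains the site [i] of its path. *)
Definition hgt (w : word) (i : int) : int := \sum_(x <- w | wl x < i) sgx x.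
Definition gle (x' x : gen) : bool := (wl x < wl x') || (x' == x).

Lemma wl_inj x y : x.1 = y.1 -> wl x = wl y -> x = y.
Proof. by case: x y => [p i] [q j] /= <-; rewrite /wl /= => /addIr <-. Qed.

(** In terms of l = j - p the required gap is 0 for equal upper indices and 1 for different ones, in
    either order. *)
Lemma gleE (x' x : gen) :
  (x.2 + (2 * Hfun x'.1 x.1)%N%:Z <= x'.2) = gle x' x.
Proof.
rewrite /gle.
have -> : (x' == x) = (x'.1 == x.1) && (wl x' == wl x).
  apply/eqP/andP => [-> //|[/eqP e1 /eqP e2]]; exact: wl_inj.
by case: x' x => [[] j'] [[] j]; rewrite /wl /Hfun /=; lia.
Qed.

Lemma normal_wordE w : normal_word w = sorted gle w.
Proof. by apply: eq_sorted => x' x; exact: gleE. Qed.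

Lemma gle_trans : transitive gle.
Proof.
move=> y x z /orP[h1|/eqP ->] // /orP[h2|/eqP <-]; rewrite /gle ?h1 //.
by rewrite (lt_trans h2 h1).
Qed.

Lemma gle_anti : antisymmetric gle.
Proof.
move=> x y /andP[/orP[h1|/eqP ->] // /orP[h2|/eqP ->] //].
by have := lt_trans h1 h2; rewrite ltxx.
Qed.

Lemma gle_wl x y : gle x y -> wl y <= wl x.
Proof. by case/orP => [/ltW|/eqP ->]. Qed.

Lemma normal_cons x w : normal_word (x :: w) = all (gle x) w && normal_word w.
Proof. by rewrite !normal_wordE /= (path_sortedE gle_trans). Qed.

Lemma normal_wl_inj w : normal_word w -> {in w &, injective wl}.
Proof.
elim: w => // z w IH; rewrite normal_cons => /andP[/allP zw nw] x y.
have zP t : t \in w -> wl z = wl t -> z = t.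
  by move=> /zw/orP[|/eqP //] + e; rewrite e ltxx.
rewrite !inE => /predU1P[->|xw] /predU1P[->|yw] // e.
- exact: zP.
- by apply/esym/zP.
- exact: IH.
Qed.

(** Walls decrease weakly from left to right, so those below [i] form a suffix. *)
Lemma drop_count_wl w i : normal_word w ->
  drop (size w - count (fun x => wl x < i) w) w = [seq x <- w | wl x < i].
Proof.
elim: w => // x w IH; rewrite normal_cons => /andP[/allP xw nw].
case: (ltP (wl x) i) => xi /=.
  have h : all (fun y => wl y < i) w.
    by apply/allP => y /xw/gle_wl yx; exact: le_lt_trans xi.
  by rewrite xi (all_filterP h) -size_filter (all_filterP h) add1n subnn.
by rewrite ltNge xi /= add0n (subSn (count_size _ _)) /= IH.
Qed.

Lemma height_tot w s : (s <= size w)%N ->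
  height (unzip1 w) s = tot (drop (size w - s) w).
Proof.
move=> sw; rewrite /height /item big_add1 /= -map_rev.
have -> : \sum_(0 <= t < s) (-1) ^+ nth false (unzip1 (rev w)) t
   = \sum_(0 <= t < s) sgx (nth ((false, 0) : gen) (rev w) t).
  apply: eq_big_nat => t /andP[_ ts]; rewrite /sgx (nth_map ((false, 0) : gen))
    //.
  by rewrite size_rev (leq_trans ts).
rewrite /tot -[RHS]big_rev -take_rev [RHS](big_nth ((false, 0) : gen))
  size_take size_rev.
have -> : (if (s < size w)%N then s else size w) = s.
  by case: ltngtP sw => // ->.
by apply: eq_big_nat => t /andP[_ ts]; rewrite nth_take.
Qed.

Lemma region_word w s : (s <= size w)%N ->
  region (word_data w) s = tot (drop (size w - s) w).
Proof.
move=> sw; rewrite /region /item -[(word_data w).2]/(rev _) revK succnK.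
rewrite (nth_map 0%N) ?size_iota //.
by rewrite nth_iota // add0n height_tot.
Qed.

Lemma wall_word w r : (1 <= r <= size w)%N ->
  wall (word_data w) r = wl (item (false, 0) w r).
Proof.
case: r => // r /= rw; rewrite /wall /item /= -map_rev.
by rewrite (nth_map ((false, 0) : gen)) ?size_rev.
Qed.

Lemma hgt_tot w i : normal_word w ->
  hgt w i = tot (drop (size w - count (fun x => wl x < i) w) w).
Proof. by move=> nw; rewrite drop_count_wl // /tot big_filter. Qed.

Lemma word_pathE k w : normal_word w ->
  word_path k w = fun i => pbar k (hgt w i) i.
Proof.
move=> nw; apply/funext => i; rewrite /word_path /path_of count_map.
by rewrite region_word ?count_size // hgt_tot.
Qed.

Definition restricted_spec (k : nat) (l : int) (w : word) :=
  [/\ normal_word w, forall s, 0 <= tot (drop s w) <= k%:Z, tot w = l &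
    all (fun x => 0 <= wl x) w].

Lemma tot0 : tot [::] = 0. Proof. exact: big_nil. Qed.

Lemma tot_cons x w : tot (x :: w) = sgx x + tot w.
Proof. exact: big_cons. Qed.

Lemma tot_cat u v : tot (u ++ v) = tot u + tot v.
Proof. exact: big_cat. Qed.

(** The first height is nonnegative, which forces p_1 = 0; the first wall is then j_1 >= 0, and the
    others are at least as large. *)
Lemma restricted_wordsP k l w :
  restricted_words k l w <-> restricted_spec k l w.
Proof.
split=> [[n [ps [[sps hps hn] [[ups nw] ge]]]]|[nw bd tw wl0]].
  have sw : size w = n by rewrite -sps -ups size_map.
  subst ps; clear sps; subst n.
  have bd s : 0 <= tot (drop s w) <= k%:Z.
    case: (ltnP s (size w)) => [lt|le]; last by rewrite drop_oversize // tot0.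
    have := hps (size w - s)%N; rewrite subn_gt0 lt leq_subr => /(_ isT).
    by rewrite height_tot ?leq_subr // subKn // ltnW.
  split=> //; first by rewrite -hn height_tot // subnn drop0.
  case/lastP: w {hps hn} nw ge bd => // w x nw;
    rewrite size_rcons item1 last_rcons.
  move=> /(_ isT) x0 /(_ (size w)); rewrite -cats1 drop_size_cat // tot_cons
    tot0.
  have wlx : sgx x + 0 >= 0 -> 0 <= wl x.
    by case: x x0 {nw} => [[] j] //= j0; rewrite /sgx /wl /=; lia.
  case/andP=> /wlx xge _; rewrite all_cat /= xge /= andbT.
  move: nw; rewrite normal_wordE -cats1 sorted_cat_cons => /andP[+ _].
  rewrite -rev_sorted rev_rcons /= path_sortedE; last first.
    by move=> b a c h1 h2; exact: gle_trans h2 h1.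
  case/andP=> /allP h _; apply/allP => y yw.
  by apply: le_trans xge (gle_wl _); apply: h; rewrite mem_rev.
exists (size w), (unzip1 w); split.
  split=> [|s /andP[s1 sw]|]; first by rewrite size_map.
    by rewrite height_tot.
  by rewrite height_tot // subnn drop0.
split=> //; rewrite item1; case/lastP: w {nw bd tw} wl0 => // w x.
rewrite all_rcons last_rcons /wl => /andP[+ _] _.
by case: x => [[] j] /=; lia.
Qed.

Lemma hgt_bounds k l w i : restricted_spec k l w -> 0 <= hgt w i <= k%:Z.
Proof. by case=> nw bd _ _; rewrite hgt_tot. Qed.

Lemma hgt_le0 k l w i : restricted_spec k l w -> i <= 0 -> hgt w i = 0.
Proof.
case=> _ _ _ /allP w0 i0; rewrite /hgt big_seq_cond big1 // => x /andP[xw].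
by move=> /lt_le_trans /(_ i0); rewrite ltNge w0.
Qed.

Lemma hgt_last w i : all (fun x => wl x < i) w -> hgt w i = tot w.
Proof. by move=> h; rewrite /hgt -big_filter (all_filterP h). Qed.

Lemma wl_bound w :
  exists N : nat, forall i, N%:Z < i -> all (fun x => wl x < i) w.
Proof.
elim: w => [|x w [N IH]]; first by exists 0%N.
exists (N + `|wl x|)%N => i iN /=; rewrite IH ?andbT; lia.
Qed.

(** At even [i] the map is the identity, at odd [i] it is m -> k - m. Hence a path and its height
    function determine each other. *)
Lemma pbarK k m i : pbar k (pbar k m i) i = m.
Proof. by rewrite /pbar eps_oddz; case: (oddz i) => /=; ring. Qed.

Lemma pbar_bounds (k : nat) m i : 0 <= m <= k%:Z -> 0 <= pbar k m i <= k%:Z.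
Proof. by rewrite /pbar eps_oddz; case: (oddz i) => /=; lia. Qed.

Lemma pbar2_pos k l i : 1 <= i -> pbar2 k l 0 i = pbar k l i.
Proof. by rewrite /pbar2 => ->. Qed.

Lemma pbar2_npos k l i : i <= 0 -> pbar2 k l 0 i = pbar k 0 i.
Proof. by rewrite /pbar2; case: ifP => //; lia. Qed.

Lemma word_path_Blambda k l w : restricted_spec k l w ->
  Blambda k l (word_path k w).
Proof.
move=> sw; have [nw _ tw _] := sw; rewrite word_pathE //.
have np i : i <= 0 -> pbar k (hgt w i) i = pbar k 0 i.
  by move=> i0; rewrite (hgt_le0 sw i0).
split=> //; split=> [i|]; first exact/pbar_bounds/(hgt_bounds _ sw).
have [N wN] := wl_bound w; exists N => i Ni.
case: (leP i 0) => i0; first by rewrite np // pbar2_npos.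
rewrite pbar2_pos ?gtz0_ge1 // hgt_last ?tw //; apply: wN.
by rewrite gtr0_norm in Ni.
Qed.

(** The only letters with wall [i] are [(false, i)], of sign 1, and [(true, i + 1)], of sign -1. *)
Lemma hgt_jump w (i : int) :
  hgt w (i + 1) - hgt w i =
  (count_mem ((false, i) : gen) w)%:Z - (count_mem ((true, i + 1) : gen) w)%:Z.
Proof.
elim: w => [|x w IH]; first by rewrite /hgt !big_nil.
rewrite /hgt !big_cons -!/(hgt _ _) /= !PoszD.
have -> : (if wl x < i + 1 then sgx x + hgt w (i + 1) else hgt w (i + 1)) =
    (wl x < i + 1)%R%:R * sgx x + hgt w (i + 1).
  by case: ifP; rewrite ?mul1r ?mul0r ?add0r.
have -> : (if wl x < i then sgx x + hgt w i else hgt w i) =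
    (wl x < i)%R%:R * sgx x + hgt w i.
  by case: ifP; rewrite ?mul1r ?mul0r ?add0r.
suff : (wl x < i + 1)%R%:R * sgx x - (wl x < i)%R%:R * sgx x =
  (x == (false, i))%:Z - (x == (true, i + 1))%:Z.
  by move=> E; rewrite !opprD addrACA E IH [RHS]addrACA.
case: x => [[] j]; rewrite !xpair_eqE /sgx /wl /=; lia.
Qed.

Lemma normal_wall_sign w (i : int) : normal_word w ->
  count_mem ((false, i) : gen) w = 0%N \/
  count_mem ((true, i + 1) : gen) w = 0%N.
Proof.
move=> nw; case: (boolP (((false, i) : gen) \in w)) => [h|/count_memPn];
  last by left.
case: (boolP (((true, i + 1) : gen) \in w)) => [h'|/count_memPn]; last by right.
by have := normal_wl_inj nw h h'; rewrite /wl /= addrK subr0 => /(_ erefl).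
Qed.

Lemma pos_neg_parts (a b c d : nat) : a%:Z - b%:Z = c%:Z - d%:Z ->
  a = 0%N \/ b = 0%N -> c = 0%N \/ d = 0%N -> a = c /\ b = d.
Proof. lia. Qed.

(** At each place at most one of the two letters occurs, so the jump gives both multiplicities, and
    these determine a sorted word. *)
Lemma hgt_inj w w' :
  normal_word w -> normal_word w' -> hgt w =1 hgt w' -> w = w'.
Proof.
move=> nw nw' h; apply: (sorted_eq gle_trans gle_anti);
  rewrite -?normal_wordE //.
have E i : count_mem ((false, i) : gen) w = count_mem ((false, i) : gen) w' /\
   count_mem ((true, i + 1) : gen) w = count_mem ((true, i + 1) : gen) w'.
  have := hgt_jump w i; rewrite !h hgt_jump => /esym e.
  exact: pos_neg_parts e (normal_wall_sign i nw) (normal_wall_sign i nw').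
apply/allP => -[[] j] _ /=; apply/eqP; last by have [] := E j.
by have [_] := E (j - 1); rewrite subrK.
Qed.

Lemma word_path_inj k w w' : normal_word w -> normal_word w' ->
  word_path k w = word_path k w' -> w = w'.
Proof.
move=> nw nw'; rewrite !word_pathE // => h; apply: hgt_inj => // i.
by rewrite -(pbarK k (hgt w i) i) (congr1 (@^~ i) h) pbarK.
Qed.

(** * Wall data *)

Lemma height_recr ps s :
  height ps s.+1 = height ps s + (-1) ^+ item false ps s.+1.
Proof. by rewrite /height big_nat_recr. Qed.

Lemma item_unzip1 (w : word) r : (1 <= r <= size w)%N ->
  item false (unzip1 w) r = (item ((false, 0) : gen) w r).1.
Proof.
case: r => // r /= rw; rewrite /item -map_rev /=.
by rewrite (nth_map ((false, 0) : gen)) ?size_rev.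
Qed.

Lemma mem_item (T : eqType) (x0 : T) (w : seq T) r :
  (1 <= r <= size w)%N -> item x0 w r \in w.
Proof. by case: r => // r rw; rewrite /item -mem_rev mem_nth ?size_rev. Qed.

Lemma region_word_height w s : (s <= size w)%N ->
  region (word_data w) s = height (unzip1 w) s.
Proof. by move=> sw; rewrite region_word // height_tot. Qed.

Lemma region_wordS w s : (s < size w)%N ->
  region (word_data w) s.+1 =
  region (word_data w) s + sgx (item ((false, 0) : gen) w s.+1).
Proof.
move=> sw; rewrite (region_word_height sw) (region_word_height (ltnW sw)).
by rewrite height_recr item_unzip1.
Qed.

Lemma wall_word_step w r : normal_word w -> (1 <= r < size w)%N ->
  gle (item ((false, 0) : gen) w r.+1) (item ((false, 0) : gen) w r).
Proof.
case: r => // r nw rw; rewrite /item /=.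
have : sorted (fun x y => gle y x) (rev w) by rewrite rev_sorted -normal_wordE.
by move/(sortedP ((false, 0) : gen)); apply; rewrite size_rev.
Qed.

Lemma word_admissible k l w : restricted_spec k l w ->
  admissible k l 0 (word_data w).
Proof.
move=> [nw bd tw _].
have sz : size (word_data w).1 = size w by rewrite size_map.
rewrite /admissible sz; split.
- split=> [|r rw]; last by rewrite region_word.
  by rewrite /word_data /= size_rev /= size_map size_iota.
- by rewrite !region_word // subnn subn0 drop0 drop_size tot0.
- case=> // r /= rw; rewrite region_wordS // addrC addKr.
  by rewrite /sgx; case: (item _ _ _).1; rewrite ?normrN1 ?normr1.
- move=> r /andP[r1 rw]; rewrite !wall_word ?r1 ?(ltnW rw) //.
  by apply/gle_wl/wall_word_step; rewrite ?r1.
move=> s s' s1 s'1 ss' _ eqw _.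
(* Letters of a normal word with the same wall are equal, so a block repeats one letter and its
   steps add up. *)
have itE t : (s <= t < s + s')%N ->
    item ((false, 0) : gen) w t = item ((false, 0) : gen) w s.
  move=> /andP[st ts].
  have tw' : (1 <= t <= size w)%N by lia.
  have sw' : (1 <= s <= size w)%N by lia.
  apply: (normal_wl_inj nw); rewrite ?mem_item // -!wall_word //.
  by apply: eqw; rewrite st.
have E j : (j <= s')%N -> region (word_data w) (s.-1 + j) =
    region (word_data w) s.-1 + sgx (item ((false, 0) : gen) w s) *+ j.
  elim: j => [|j IH] js; first by rewrite addn0 mulr0n addr0.
  rewrite addnS region_wordS; last by lia.
  rewrite IH 1?ltnW // itE; last by lia.
  by rewrite -addrA -mulrSr.
have -> : (s + s').-1 = (s.-1 + s')%N by lia.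
rewrite E // addrC addKr normrMn /sgx.
by case: (item _ _ _).1; rewrite ?normrN1 ?normr1 natz.
Qed.

(** * Admissible wall data come from normal words *)

Section AdmissibleData.
Variables (k : nat) (m : int) (d : wall_data).
Hypothesis adm : admissible k m 0 d.
Let n := size d.1.
Let W := wall d.
Let M := region d.
Let down r := M r < M r.-1.

Lemma wall_mono a b : (1 <= a)%N -> (a <= b)%N -> (b <= n)%N -> W a <= W b.
Proof.
have [_ _ _ mono _] := adm.
move=> a1; elim: b => [|b IH]; first by rewrite leqn0 => /eqP ->.
rewrite leq_eqVlt => /predU1P[-> //|ab] bn.
by apply: le_trans (IH ab (ltnW bn)) (mono _ _); rewrite bn (leq_trans a1 ab).
Qed.

Lemma region_step r : (r < n)%N -> M r.+1 = M r + (-1) ^+ down r.+1.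
Proof.
have [_ _ step _ _] := adm.
move=> rn; have := step r.+1; rewrite rn => /(_ isT) /=.
by rewrite /down /= -!/(M _); case: (ltP (M r.+1)) => h /=; lia.
Qed.

Lemma region_dist a b : (a <= b)%N -> (b <= n)%N -> `|M b - M a| <= (b - a)%:Z.
Proof.
elim: b => [|b IH]; first by rewrite leqn0 => /eqP -> _; rewrite subrr.
rewrite leq_eqVlt => /predU1P[-> _|ab bn]; first by rewrite subrr subnn.
have := IH ab (ltnW bn); rewrite region_step //; case: (down _) => /=; lia.
Qed.

(* A block of s' equal walls moves the region by s', so all its steps go the
   same way. *)
Lemma equal_wall_down r : (1 <= r < n)%N -> W r = W r.+1 -> down r = down r.+1.
Proof.
move=> /andP[r1 rn] eW; have [_ _ _ _ block] := adm.
pose P s := [&& 1 <= s, s <= n & W s == W r]%N.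
have exP : exists s, P s by exists r; rewrite /P r1 ltnW //=.
have bdP s : P s -> (s <= n)%N by case/and3P.
(* The walls [s] to [e] form the maximal block around [r]; maximality yields the strict inequalities
   in the block condition. *)
case: (ex_minnP exP) => s /and3P[s1 sn /eqP Ws] mins.
case: (ex_maxnP exP bdP) => e /and3P[e1 en /eqP We] maxe.
have sr : (s <= r)%N by apply: mins; rewrite /P r1 ltnW //=.
have re : (r.+1 <= e)%N by apply: maxe; rewrite /P rn -eW eqxx.
have := block s (e.+1 - s)%N s1; rewrite subnKC -1?ltnS 1?(leq_trans sr) //;
  last by lia.
move=> h; have {}h : `|M e - M s.-1| = (e.+1 - s)%:Z.
  apply: h => //; first by lia.
  - move=> e1n; rewrite lt_neqAle wall_mono ?andbT //=.
    apply/eqP => eqW; have {}eqW : W e.+1 = W e := esym eqW.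
    have : (e.+1 <= e)%N by apply: maxe; rewrite /P e1n eqW We eqxx.
    by rewrite ltnn.
  - move=> t /andP[st te]; change (W t = W s); apply/eqP; rewrite eq_le;
      apply/andP; split.
      by rewrite Ws -We; apply: wall_mono => //; lia.
    by apply: wall_mono => //; lia.
  - move=> s2; rewrite lt_neqAle wall_mono ?andbT //; try lia.
    apply/eqP => eqW; have {}eqW : W s.-1 = W s := eqW.
    have : (s <= s.-1)%N by apply: mins; rewrite /P eqW Ws eqxx; lia.
    by lia.
(* Opposite steps at [r] and [r.+1] would cancel, so the block of e + 1 - s walls would move the
   region by at most e - s - 1. *)
apply/eqP; apply: contraT => ne; move: h.
have := @region_dist r.+1 e re en.
have := @region_dist s.-1 r.-1; rewrite -ltnS !prednK // => /(_ sr).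
have := @region_step r rn; have := @region_step r.-1; rewrite prednK //.
move=> /(_ (ltnW rn)); move: ne; case: (down r); case: (down r.+1) => //= _;
  lia.
Qed.

(** The inverse of [word_data]: p = 1 exactly where the region drops, and j = l + p, listed from the
    last wall down to the first. *)
Definition data_word : word :=
  [seq (down (n - i), W (n - i)%N + (down (n - i) : nat)%:Z) | i <- iota 0 n].

Lemma size_data_word : size data_word = n.
Proof. by rewrite size_map size_iota. Qed.

Lemma item_data_word r : (1 <= r <= n)%N ->
  item ((false, 0) : gen) data_word r = (down r, W r + (down r : nat)%:Z).
Proof.
move=> /andP[r1 rn]; rewrite /item nth_rev size_data_word ?prednK //.
rewrite (nth_map 0%N) ?size_iota; last by lia.
by rewrite nth_iota ?add0n ?subKn //; lia.
Qed.

Lemma data_wordK : word_data data_word = d.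
Proof.
have [[s2 _] [_ M0] _ _ _] := adm.
rewrite [d]surjective_pairing /word_data size_data_word; congr pair.
  apply: (@eq_from_nth _ 0); rewrite size_map size_data_word // => i ni.
  rewrite (nth_map ((false, 0) : gen)) ?size_data_word // (nth_map 0%N)
    ?size_iota //.
  rewrite nth_iota //= add0n addrK /W /wall /item nth_rev -/n; last by lia.
  by congr nth; lia.
rewrite -[RHS]revK; congr rev; apply: (@eq_from_nth _ 0).
  by rewrite size_rev s2 size_map size_iota.
move=> s; rewrite size_map size_iota => sn.
rewrite (nth_map 0%N) ?size_iota // nth_iota // add0n.
change (height (unzip1 data_word) s = M s).
elim: s sn => [|s IH] sn; first by rewrite /height big_geq // -[LHS]M0.
rewrite height_recr IH 1?ltnW // region_step // item_unzip1 ?size_data_word //.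
by rewrite item_data_word.
Qed.

Lemma data_word_normal : normal_word data_word.
Proof.
rewrite normal_wordE; apply/(sortedP ((false, 0) : gen)) => i.
rewrite size_data_word => i1.
have E j : (j < n)%N -> nth ((false, 0) : gen) data_word j =
    (down (n - j), W (n - j)%N + (down (n - j) : nat)%:Z).
  by move=> jn; rewrite (nth_map 0%N) ?size_iota // nth_iota.
rewrite !E // 1?ltnW //; have -> : (n - i = (n - i.+1).+1)%N by lia.
set r := (n - i.+1)%N; have rn : (1 <= r < n)%N by lia.
rewrite /gle /wl /= !addrK.
have := @wall_mono r r.+1; rewrite leqnSn => /(_ _ _ _).
have [r1 rn'] := andP rn => /(_ r1 isT rn').
(* For equal walls [gle] asks for equal letters, which is where the block condition enters. *)
rewrite le_eqVlt => /predU1P[eW|-> //].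
by rewrite -eW -(equal_wall_down rn eW) eqxx orbT.
Qed.

End AdmissibleData.

(** Any admissible data are the data of a normal word, and normal words are separated by their
    paths, so the choice in [data_of] is forced. *)
Lemma data_of_word k l w : restricted_spec k l w ->
  data_of k l 0 (word_path k w) = word_data w.
Proof.
move=> sw; rewrite /data_of.
case: xgetP => [d _ [adm eqp]|/(_ (word_data w))[]].
  have [nw _ _ _] := sw.
  rewrite -{1}(data_wordK adm); congr word_data.
  apply: (word_path_inj (k := k)) => //; first exact: (data_word_normal adm).
  by rewrite /word_path (data_wordK adm).
by split=> //; exact: word_admissible.
Qed.

(** * Words of a given height function *)

Lemma tot_drop_nseq c x s : tot (drop s (nseq c x)) = sgx x *+ (c - s).
Proof.
rewrite drop_nseq; elim: (c - s)%N => [|j IH]; first by rewrite tot0.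
by rewrite /= tot_cons IH mulrS.
Qed.

(** The word is built from the right: the step from [m N] to [m N.+1] prepends |m(N+1) - m(N)| equal
    letters with wall [N] and the sign of the difference. *)
Lemma build_word k (m : nat -> int) :
  (forall i, 0 <= m i <= k%:Z) -> m 0%N = 0 ->
  forall N, exists w, [/\ restricted_spec k (m N) w,
    all (fun x => wl x < N%:Z) w &
    forall i : nat, (i <= N)%N -> hgt w i%:Z = m i].
Proof.
move=> mb m0; elim=> [|N [w [[nw bd tw w0] wN hw]]].
  exists [::]; split=> //; first split=> //; first by move=> s; rewrite tot0.
    by rewrite tot0.
  by case=> // _; rewrite m0 /hgt big_nil.
pose p := m N.+1 < m N; pose c := `|m N.+1 - m N|%N.
pose x : gen := (p, N%:Z + (p : nat)%:Z).
have wlx : wl x = N by rewrite /wl addrK.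
have sc : sgx x *+ c = m N.+1 - m N.
  rewrite /sgx /c /= /p; case: ltP => h; rewrite ?expr1 ?expr0 ?mulNrn natz;
    lia.
have tot' s : tot (drop s (nseq c x ++ w)) =
   if (s < c)%N then sgx x *+ (c - s) + m N else tot (drop (s - c) w).
  rewrite drop_cat size_nseq; case: ifP => // _.
  by rewrite tot_cat tot_drop_nseq tw.
have wN1 : all (fun y => wl y < N.+1%:Z) (nseq c x ++ w).
  rewrite all_cat; apply/andP; split.
    by apply/allP => y; rewrite mem_nseq => /andP[_ /eqP ->]; rewrite wlx; lia.
  by apply: sub_all wN => y; lia.
have totE : tot (nseq c x ++ w) = m N.+1.
  rewrite -[nseq c x ++ w]drop0 tot'; case: ltnP => [_|];
    first by rewrite subn0 sc subrK.
  by rewrite leqn0 => /eqP c0; rewrite c0 subn0 drop0 tw; move: sc;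
    rewrite c0 mulr0n; lia.
exists (nseq c x ++ w); split=> //.
- split=> //.
  + rewrite normal_wordE; elim: c {sc tot' wN1 totE} => [|c IH] /=.
      by rewrite -normal_wordE.
    rewrite (path_sortedE gle_trans) IH andbT all_cat; apply/andP; split.
      by apply/allP => y; rewrite mem_nseq => /andP[_ /eqP ->];
        rewrite /gle eqxx orbT.
    by apply: sub_all wN => y; rewrite /gle wlx => ->.
  (* Within the new block the suffix sums run monotonically from [m N] to [m N.+1], hence stay in
     the bounds. *)
  + move=> s; rewrite tot'; case: ifP => // sc'; move: sc (mb N) (mb N.+1).
    rewrite /sgx; case: (x.1); rewrite ?expr1 ?expr0 ?mulNrn !natz; lia.
  + rewrite all_cat w0 andbT; apply/allP => y;
      rewrite mem_nseq => /andP[_ /eqP ->].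
    by rewrite wlx.
move=> i; rewrite leq_eqVlt => /predU1P[->|]; first by rewrite hgt_last.
rewrite ltnS => iN; rewrite -(hw i iN) /hgt big_cat /= big_seq_cond big1 ?add0r
  //.
move=> y; rewrite mem_nseq => /andP[/andP[_ /eqP ->]]; rewrite wlx; lia.
Qed.

Lemma word_path_surj k (l : int) p : Blambda k l p ->
  exists2 w, restricted_spec k l w & word_path k w = p.
Proof.
move=> [[pb [N pN]] p0]; pose m (i : int) := pbar k (p i) i.
have mb i : 0 <= m i <= k%:Z by apply: pbar_bounds.
have m0 i : i <= 0 -> m i = 0 by move=> i0; rewrite /m p0 // pbarK.
have m00 : m 0%N%:Z = 0 by apply: m0.
have mN i : N%:Z < i -> m i = l.
  by move=> Ni; rewrite /m pN ?pbar2_pos ?pbarK //; lia.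
(* The value [l] of [m] is guaranteed only beyond [N], hence the bound [N.+1]. *)
have [w [sw wN hw]] :=
  @build_word k (fun i => m i%:Z) (fun i => mb i%:Z) m00 N.+1.
rewrite mN in sw; last by lia.
exists w => //; have [nw _ tw _] := sw.
rewrite word_pathE //; apply/funext => i.
suff -> : hgt w i = m i by rewrite pbarK.
case: (leP i 0) => i0; first by rewrite (hgt_le0 sw i0) m0.
case: (leP i N.+1%:Z) => iN.
  have -> : i = `|i|%N%:Z by lia.
  by rewrite hw //; lia.
have -> : m i = l by apply: mN; lia.
rewrite hgt_last ?tw //.
by apply: sub_all wN => y /lt_trans; apply.
Qed.

(** * Crystal operators and weights *)

Definition bit (x : gen) : bool := oddz x.2.

(** At a wall l, p(l) + p(l+1) - k is the jump of the height for odd l and its negative for even l.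
    The jump is nonzero with the sign of [x], so the bit is the parity of l + p = j. *)
Lemma wall_bitE k w x : normal_word w -> x \in w ->
  wall_bit k (word_path k w) (wl x) = bit x.
Proof.
move=> nw xw; rewrite word_pathE // /wall_bit /pbar !eps_oddz oddzD1.
have c0 : (0 < count_mem x w)%N by rewrite -has_count has_pred1.
have := hgt_jump w (wl x); have := normal_wall_sign (wl x) nw.
rewrite /bit -[x.2](subrK (x.1 : nat)%:Z) -/(wl x).
have ex : x = (x.1, wl x + (x.1 : nat)%:Z) by rewrite subrK -surjective_pairing.
move: c0; rewrite {1}ex; move: (hgt w _) (hgt w _) => b a.
case: x.1 => /=.
  move: (count_mem _ w) (count_mem _ w) => c d.
  by rewrite oddzD1; case: (oddz _) => /=; case: ltP => //; lia.
rewrite addr0; move: (count_mem _ w) (count_mem _ w) => c d.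
by case: (oddz _) => /=; case: ltP => //; lia.
Qed.

(** The change of parity makes the two bit sequences differ exactly at [x], so [move_wall] shifts
    the wall of [x] and no other. *)
Lemma word_path_move k c u x v : oddz (x.2 + c) != oddz x.2 ->
  let w := u ++ x :: v in let w' := u ++ (x.1, x.2 + c) :: v in
  path_of k (move_wall c (map bit w) (map bit w') (word_data w).1,
             (word_data w).2)
  = word_path k w'.
Proof.
move=> ox w w'; rewrite /word_path; congr path_of.
have e1 : unzip1 w' = unzip1 w by rewrite /unzip1 !map_cat.
have sz : size w' = size w by rewrite -(size_map fst) -/(unzip1 _) e1 size_map.
rewrite /word_data e1 sz; congr pair; rewrite -!/(wl _) /w /w'.
have mv s : move_wall c (map bit s) (map bit s) (map wl s) = map wl s.
  by elim: s => //= y s; rewrite /move_wall /= eqxx => ->.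
elim: {w w' e1 sz} u => [|y u IH]; last first.
  by rewrite /= /move_wall /= eqxx; congr cons; exact: IH.
rewrite /= /move_wall /= {1}/bit {1}/bit eq_sym (negbTE ox); congr cons;
  last exact: mv.
by rewrite /wl addrAC.
Qed.

Lemma bit_et x : et B1_ops (bit x) = omap bit (et gen_ops x).
Proof.
rewrite /= -/(oddz x.2) -/(bit x); case: ifP => bx //=.
by rewrite /bit oddzB1 -/(bit x) bx.
Qed.

Lemma bit_ft x : ft B1_ops (bit x) = omap bit (ft gen_ops x).
Proof.
have -> : ft gen_ops x = if bit x then None else Some (x.1, x.2 + 1).
  by rewrite /= eps_oddz -/(bit x); case: (bit x).
by rewrite /=; case bx: (bit x) => //=; rewrite /bit oddzD1 -/(bit x) bx.
Qed.

Lemma bits_of_walls k w : normal_word w ->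
  [seq wall_bit k (word_path k w) l | l <- (word_data w).1] = map bit w.
Proof.
by move=> nw; rewrite -map_comp; apply/eq_in_map => x xw; exact: wall_bitE.
Qed.

Lemma path_et_word k l w : restricted_spec k l w ->
  et (path_ops k l 0) (word_path k w) = omap (word_path k) (et word_ops w).
Proof.
move=> sw; have [nw _ _ _] := sw.
rewrite word_ops_et // [LHS]/= /path_op data_of_word // bits_of_walls //
  size_map.
have [-> _] := tensor_pow_morph bit_et bit_ft (size w) w.
case ew: (et _ w) => [w'|] //=; congr Some.
have [//|u [x [v [ew1 -> ox _]]]] := tensor_etP _ ew.
by rewrite ew1; apply: word_path_move; rewrite oddzB1; case: (oddz _).
Qed.

Lemma path_ft_word k l w : restricted_spec k l w ->
  ft (path_ops k l 0) (word_path k w) = omap (word_path k) (ft word_ops w).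
Proof.
move=> sw; have [nw _ _ _] := sw.
rewrite word_ops_ft // [LHS]/= /path_op data_of_word // bits_of_walls //
  size_map.
have [_ ->] := tensor_pow_morph bit_et bit_ft (size w) w.
case ew: (ft _ w) => [w'|] //=; congr Some.
have [u [x [v [ew1 -> ox _]]]] := tensor_ftP ew.
by rewrite ew1; apply: word_path_move; rewrite oddzD1; case: (oddz _).
Qed.

(** * Affine weights as sums over the walls *)

Lemma fsum_int_range (F : int -> int) (N : nat) :
  (forall i, F i != 0 -> 0 <= i < N%:Z) ->
  \sum_(i \in [set: int]) F i = \sum_(0 <= i < N) F i%:Z.
Proof.
move=> F0; rewrite -(big_map Posz xpredT F) (fsbig_seq _ (r := map Posz _));
  last first.
  by rewrite map_inj_uniq ?iota_uniq // => a b [].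
apply/esym/fsbig_widen => //= i /= [_ iN]; apply/eqP; apply: contraT => /F0 h.
case: iN; apply/mapP; exists `|i|%N; rewrite ?mem_index_iota; lia.
Qed.

(** The contribution of a single wall at [n] to s(p), up to its sign: an alternating sum over the
    sites 1 to n. *)
Lemma sum_sign (N n : nat) : (n < N)%N ->
  \sum_(0 <= i < N) ((1 <= i <= n)%N%:Z * (1 - 2 * eps i%:Z)) = - eps n%:Z.
Proof.
move=> nN; rewrite (big_cat_nat _ (n := n.+1)) //= [X in _ + X]big_nat_cond.
rewrite [X in _ + X]big1 ?addr0; last first.
  by move=> i /andP[/andP[ni _] _]; rewrite [(i <= n)%N]leqNgt ni andbF mul0r.
have -> : \sum_(0 <= i < n.+1) ((1 <= i <= n)%N%:Z * (1 - 2 * eps i%:Z)) =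
          \sum_(0 <= i < n.+1) ((1 <= i)%N%:Z * (1 - 2 * eps i%:Z)).
  by apply: eq_big_nat => i /andP[_]; rewrite ltnS => ->; rewrite andbT.
elim: n {nN} => [|n IH]; first by rewrite big_nat1 mul0r.
rewrite big_nat_recr //= IH mul1r -natr1 natz /eps; lia.
Qed.

(** The analogous sum for h(p), doubled to avoid a division. *)
Lemma sum_sign_index (N n : nat) : (n < N)%N ->
  2 * \sum_(0 <= i < N) (i%:Z * ((i <= n)%N%:Z * (1 - 2 * eps i%:Z))) =
  (1 - 2 * eps n%:Z) * n%:Z - eps n%:Z.
Proof.
move=> nN; rewrite (big_cat_nat _ (n := n.+1)) //= [X in _ + X]big_nat_cond.
rewrite [X in _ + X]big1 ?addr0; last first.
  by move=> i /andP[/andP[ni _] _]; rewrite [(i <= n)%N]leqNgt ni mul0r mulr0.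
have -> : \sum_(0 <= i < n.+1) (i%:Z * ((i <= n)%N%:Z * (1 - 2 * eps i%:Z))) =
          \sum_(0 <= i < n.+1) (i%:Z * (1 - 2 * eps i%:Z)).
  by apply: eq_big_nat => i /andP[_]; rewrite ltnS => ->; rewrite mul1r.
elim: n {nN} => [|n IH]; first by rewrite big_nat1 !mul0r.
rewrite big_nat_recr //= mulrDr IH; have -> : n.+1%:Z = n%:Z + 1 by lia.
rewrite !eps_oddz oddzD1.
by case: (oddz n%:Z) => /=; ring.
Qed.

Lemma count_sum (a : pred gen) w : (count a w)%:Z = \sum_(x <- w) (a x)%:Z.
Proof. by elim: w => [|x w IH]; rewrite ?big_nil // big_cons -IH /= PoszD. Qed.

Lemma tot_sub_hgt w i :
  tot w - hgt w i = \sum_(x <- w) sgx x * (i <= wl x)%R%:Z.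
Proof.
rewrite /tot /hgt [X in _ - X]big_mkcond -sumrB; apply: eq_bigr => x _.
by case: leP => _; rewrite ?mulr1 ?mulr0 ?subr0 ?subrr.
Qed.

Lemma odd_walls w (i : int) :
  (if oddz i then (count_mem ((false, i) : gen) w)%:Z
   else (count_mem ((true, i + 1) : gen) w)%:Z) =
  \sum_(x <- w) (wl x == i)%:Z * (bit x)%:Z.
Proof.
rewrite (fun_if (fun n : int => n)) !count_sum.
have -> : forall b (A B : int), (if b then A else B) = b%:Z * A + (~~ b)%:Z * B.
  by case=> A B; rewrite mul1r mul0r ?addr0 ?add0r.
rewrite !mulr_sumr -big_split; apply: eq_bigr => -[[] j] _ /=;
  rewrite !xpair_eqE /wl /bit /= ?addr0 ?subr0 ?add0r.
  rewrite mulr0 add0r subr_eq; case: eqP => [->|]; last by rewrite mulr0 mul0r.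
  by rewrite oddzD1 mulr1 mul1r.
rewrite mulr0 addr0; case: eqP => [->|]; last by rewrite mulr0 mul0r.
by rewrite mulr1 mul1r.
Qed.

(** The value is max(a, b) - k for odd [i] and -min(a, b) for even [i]; [c] and [d] are the positive
    and negative parts of b - a. *)
Lemma Htilde_pbar (k : nat) (i a b : int) (c d : nat) :
  b - a = c%:Z - d%:Z -> c = 0%N \/ d = 0%N ->
  Htilde k (pbar k b (i + 1)) (pbar k a i) =
  if oddz i then a + c%:Z - k%:Z else d%:Z - a.
Proof.
move=> h cd; rewrite /Htilde /pbar !eps_oddz oddzD1.
by case: (oddz i) => /=; case: ifP; lia.
Qed.

Lemma gen_weight x :
  sgx x * (1 - 2 * eps (wl x)) = 1 - 2 * eps x.2.
Proof.
rewrite !eps_oddz; case: x => [[] j]; rewrite /sgx /wl /= ?subr0 ?oddzB1;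
  by case: (oddz j) => /=; ring.
Qed.

Section Weights.
Variables (k : nat) (l : int) (w : word) (N : nat).
Hypothesis sw : restricted_spec k l w.
Hypothesis wN : all (fun x => wl x < N%:Z) w.

Lemma hgt_ge_bound i : N%:Z <= i -> hgt w i = l.
Proof.
move=> Ni; have [_ _ <- _] := sw; apply: hgt_last.
by apply: sub_all wN => x /lt_le_trans; apply.
Qed.

Lemma pbar_sub (a b i : int) :
  pbar k a i - pbar k b i = (1 - 2 * eps i) * (a - b).
Proof. by rewrite /pbar; ring. Qed.

Lemma wlP x : x \in w -> exists2 n : nat, (n < N)%N & wl x = n%:Z.
Proof.
move=> xw; have [_ _ _ /allP /(_ _ xw) w0] := sw; have := allP wN _ xw.
by exists `|wl x|%N; lia.
Qed.

(** At i >= 1 the path deviates from the ground state by (-1)^i times the signed number of walls at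
    or beyond [i]; exchanging the sums isolates each wall. *)
Lemma path_s_word :
  path_s k l 0 (word_path k w) = - \sum_(x <- w) sgx x * eps (wl x).
Proof.
have [nw _ tw _] := sw; rewrite /path_s word_pathE // (@fsum_int_range _ N).
  have -> : \sum_(0 <= i < N) (pbar2 k l 0 i%:Z - pbar k (hgt w i%:Z) i%:Z) =
      \sum_(0 <= i < N) \sum_(x <- w)
        sgx x * ((1 <= i)%N%:Z * ((i%:Z <= wl x)%R%:Z * (1 - 2 * eps i%:Z))).
    apply: eq_bigr => i _; case: i => [|i].
      rewrite pbar2_npos // (hgt_le0 sw) // subrr big1 // => x _.
      by rewrite mul0r mulr0.
    rewrite pbar2_pos // pbar_sub -tw tot_sub_hgt mulr_sumr.
    by apply: eq_bigr => x _; rewrite mul1r mulrC mulrA.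
  rewrite exchange_big -sumrN; apply: eq_big_seq => x xw /=.
  have [n nN ->] := wlP xw; rewrite -mulr_sumr -mulrN -(sum_sign nN);
    congr (_ * _).
  apply: eq_bigr => i _; rewrite mulrA lez_nat; congr (_ * _).
  by case: (1 <= i)%N; rewrite ?mul1r ?mul0r.
move=> i; case: (leP i 0) => i0.
  by rewrite pbar2_npos // (hgt_le0 sw) // subrr eqxx.
case: (ltP i N%:Z) => iN; first by rewrite ltW.
by rewrite pbar2_pos // hgt_ge_bound // subrr eqxx.
Qed.

Lemma path_h_term i : 1 <= i ->
  Htilde k (word_path k w (i + 1)) (word_path k w i) -
  Htilde k (pbar2 k l 0 (i + 1)) (pbar2 k l 0 i) =
  \sum_(x <- w) (sgx x * ((i <= wl x)%R%:Z * (1 - 2 * eps i)) +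
                 (wl x == i)%:Z * (bit x)%:Z).
Proof.
have [nw _ tw _] := sw; move=> i1; rewrite word_pathE //.
rewrite (Htilde_pbar _ _ (hgt_jump w i) (normal_wall_sign i nw)).
rewrite !pbar2_pos //; last by lia.
have e0 : l - l = 0%N%:Z - 0%N%:Z by rewrite !subrr.
rewrite (Htilde_pbar _ _ e0 (or_introl erefl)) big_split /= -odd_walls.
have -> : \sum_(x <- w) sgx x * ((i <= wl x)%R%:Z * (1 - 2 * eps i)) =
   (l - hgt w i) * (1 - 2 * eps i).
  by rewrite -tw tot_sub_hgt mulr_suml; apply: eq_bigr => x _; rewrite mulrA.
by rewrite eps_oddz; case: (oddz i) => /=; ring.
Qed.

(** The two contributions of one wall to h(p), the alternating sum up to it and the correction at
    the wall itself, add up to floor(j/2). *)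
Lemma half_index (p : bool) (j T : int) :
  let n := j - (p : nat)%:Z in
  2 * T = (1 - 2 * eps n) * n - eps n ->
  (-1) ^+ p * T + n * (oddz j)%:Z = (j %/ 2)%Z.
Proof.
move=> n; rewrite /n eps_oddz; have := oddzE j.
by case: p {n}; rewrite ?oddzB1 ?subr0; case: (oddz j) => /=; lia.
Qed.

Lemma path_h_word :
  path_h k l 0 (word_path k w) = \sum_(x <- w) (x.2 %/ 2)%Z.
Proof.
have [nw _ tw _] := sw; rewrite /path_h (@fsum_int_range _ N).
  have -> : \sum_(0 <= i < N) (i%:Z *
        (Htilde k (word_path k w (i%:Z + 1)) (word_path k w i%:Z) -
         Htilde k (pbar2 k l 0 (i%:Z + 1)) (pbar2 k l 0 i%:Z))) =
      \sum_(0 <= i < N) \sum_(x <- w)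
        (sgx x * (i%:Z * ((i%:Z <= wl x)%R%:Z * (1 - 2 * eps i%:Z))) +
         (wl x == i%:Z)%:Z * i%:Z * (bit x)%:Z).
    apply: eq_bigr => i _; case: i => [|i].
      rewrite mul0r big1 // => x _.
      by rewrite mul0r !mulr0 mul0r addr0.
    rewrite path_h_term // mulr_sumr; apply: eq_bigr => x _.
    by rewrite mulrDr mulrCA; congr (_ + _);
      rewrite mulrA [_ * (_ == _)%:Z]mulrC.
  rewrite exchange_big; apply: eq_big_seq => x xw /=; rewrite big_split /=.
  have [n nN ex] := wlP xw; rewrite -mulr_sumr -mulr_suml.
  have -> : \sum_(0 <= i < N) (wl x == i%:Z)%:Z * i%:Z = wl x.
    rewrite ex (bigD1_seq n) ?iota_uniq ?mem_index_iota //= eqxx mul1r big1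
      ?addr0 //.
    by move=> i ni; rewrite eqz_nat eq_sym (negbTE ni) mul0r.
  apply: half_index; rewrite -/(wl x) ex -(sum_sign_index nN); congr (_ * _).
move=> i; case: (leP i 0) => i0.
  (* At i = 0 the factor [i] kills the term, whatever walls lie at 0; for i < 0 both sites lie in
     the region 0. *)
  rewrite le_eqVlt in i0; case/predU1P: i0 => [->|i0];
    first by rewrite mul0r eqxx.
  rewrite word_pathE // !(hgt_le0 sw) ?(ltW i0) //; last by lia.
  by rewrite !pbar2_npos ?(ltW i0) // ?subrr ?mulr0 ?eqxx //; lia.
case: (ltP i N%:Z) => iN; first by rewrite ltW.
rewrite word_pathE // !hgt_ge_bound //; last by lia.
by rewrite !pbar2_pos // ?subrr ?mulr0 ?eqxx //; lia.
Qed.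

Lemma word_wtE (u : word) : word_wt u =
  (Lambda1 - Lambda0) *~ (\sum_(x <- u) (1 - 2 * eps x.2))
  - delta *~ (\sum_(x <- u) (x.2 %/ 2)%Z).
Proof.
rewrite /word_wt; elim: u => [|x u IH]; first by rewrite !big_nil !mulr0z subr0.
rewrite !big_cons IH /gen_wt !mulrzDr mulrNz opprD.
by rewrite (addrC (- _)) addrACA.
Qed.

Lemma path_wt_word : path_wt k l 0 (word_path k w) = word_wt w.
Proof.
rewrite word_wtE /path_wt path_h_word path_s_word; congr (_ *~ _ - _).
have [_ _ <- _] := sw; rewrite subr0 mulrN mulr_sumr -sumrB;
  apply: eq_bigr => x _.
rewrite -gen_weight; move: (sgx x) (eps (wl x)) => a b; rewrite mulrBr mulrCA.
by congr (_ - _); rewrite mulr1.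
Qed.

End Weights.

(** * The crystal isomorphism *)

Theorem corollary3 (k l : nat) (hk : (1 <= k)%N) (hl : (l <= k)%N) :
  (forall w : word, restricted_words k l%:Z w -> admissible k l%:Z 0%R (word_data w)) /\
  crystal_iso word_ops word_wt (restricted_words k l%:Z)
              (path_ops k l%:Z 0%R) (path_wt k l%:Z 0%R) (Blambda k l%:Z)
              (word_path k).
Proof.
split=> [w /restricted_wordsP sw|]; first exact: word_admissible sw.
have stable := @restricted_words_stable k l%:Z.
split.
(* Stability on the path side is transported from the words by surjectivity. *)
- split=> // p q /word_path_surj[w sw <-]; rewrite path_et_word // path_ft_word //.
  have rw : restricted_words k l%:Z w by apply/restricted_wordsP.
  case=> [|]; case e: (_ word_ops w) => [w'|] //= [<-];
    apply/word_path_Blambda/restricted_wordsP; apply: (stable w w' rw).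
    by left.
  by right.
- split=> [w /restricted_wordsP|w w'|p /word_path_surj[w sw <-]].
  + exact: word_path_Blambda.
  + move=> /set_mem/restricted_wordsP[nw _ _ _].
    move=> /set_mem/restricted_wordsP[nw' _ _ _].
    exact: word_path_inj.
  + by exists w => //; apply/restricted_wordsP.
- by move=> w /restricted_wordsP; exact: path_et_word.
- by move=> w /restricted_wordsP; exact: path_ft_word.
move=> w /restricted_wordsP sw; have [N wN] := wl_bound w.
by apply: (path_wt_word (N := N.+1) sw); apply: wN; rewrite ltz_nat.
Qed.
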